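(* Let $K$ be a field, let $E$ be a finite quiver and let $R$ be a $K$-subalgebra of $P((E))$ containing $P(E)$ and closed under inversion (in $P((E))$) and under all the transductions $\delta_e$ and $\tilde\delta_e$, $e\in E^1$. Set $S=R\langle\overline E;\tau,\delta\rangle$, $I=SqS$ and $T=S/I$. Then there is a canonical isomorphism of monoids $M_E\cong\mathcal V(T)$.
   Context: $E=(E^0,E^1,r,s)$ is a finite quiver with $E^0=\{1,\dots,d\}$; $s(e)$ and $r(e)$ are the source and range of an arrow $e$. A path is a trivial path $p_i$ ($i\in E^0$, length $0$, $s(p_i)=r(p_i)=i$) or a sequence $e_1\cdots e_n$ of arrows with $r(e_t)=s(e_{t+1})$; its source is $s(e_1)$, its range $r(e_n)$. $E^*$ is the set of all paths. $P(E)$ is the path $K$-algebra (basis $E^*$, product by concatenation, $p_{s(e)}e=ep_{r(e)}=e$). $P((E))$ is the algebra of formal power series: possibly infinite sums $\sum_{\gamma\in E^*}\lambda_\gamma\gamma$, $\lambda_\gamma\in K$. $R$ is closed under inversion in $P((E))$ if every element of $R$ invertible in $P((E))$ is invertible in $R$. For $e\in E^1$ the left transduction $\delta_e$ (written on the right) is $(\sum_\alpha\lambda_\alpha\alpha)\delta_e=\sum_{r(\alpha)=s(e)}\lambda_{\alpha e}\alpha$, and the right transduction is $\tilde\delta_e(\sum_\alpha\lambda_\alpha\alpha)=\sum_{s(\alpha)=r(e)}\lambda_{e\alpha}\alpha$. Also $\tau_e$ (written on the right) is the $K$-algebra endomorphism interchanging $p_{s(e)}$ and $p_{r(e)}$,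 fixing $p_i$ for $i\ne s(e),r(e)$, and killing all series with no terms of length $0$. Inverse quiver $\overline E$: same vertices, arrows $\overline e$ ($e\in E^1$) with source $r(e)$ and range $s(e)$. $R\langle\overline E;\tau,\delta\rangle$ is the subring of $\mathrm{End}_K(R)$ (endomorphisms acting on the right) generated by the right multiplications by elements of $R$ and by the operators $\delta_e$, $e\in E^1$; $r\in R$ is identified with right multiplication by $r$ and $\overline e$ with $\delta_e$. Then $r\overline e=\overline e(r\tau_e)+(r\delta_e)$ for $r\in R$, $e\in E^1$. Let $X\subseteq E^0$ be the set of vertices that are not sources, i.e. with $r^{-1}(i)\ne\emptyset$. For $i\in X$ put $q_i=p_i-\sum_{e\in r^{-1}(i)}\overline e e$, and $q=\sum_{i\in X}q_i$. $\mathcal V(A)$ is the monoid (under direct sum) of isomorphism classes of finitely generated projective right $A$-modules. $M_E$ is the quotient of the free abelian monoid $F_E$ on $E^0$ by the congruence $\sim$ generated by the pairs $(v,\sum_{\{e\in E^1\mid r(e)=v\}}s(e))$ for all $v\in E^0$ with $r^{-1}(v)\ne\emptyset$. The canonical map $M_E\to\mathcal V(T)$ sends the class of $v\in E^0$ to $[p_vT]$. *)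

(* Defs.v *)
From HB Require Import structures.
From mathcomp Require Import all_boot all_algebra.
From mathcomp Require Import boolp classical_sets functions cardinality.

Set Implicit Arguments.
Unset Strict Implicit.
Unset Printing Implicit Defensive.

Import GRing.Theory.

Local Open Scope ring_scope.
Local Open Scope quotient_scope.

Record quiver := Quiver {
  vert : finType;
  arr : finType;
  src : arr -> vert;
  rng : arr -> vert
}.

Arguments src {q} e.
Arguments rng {q} e.

Section Paths.
Variable E : quiver.
Implicit Types (v : vert E) (e : arr E) (s : seq (arr E)).

Fixpoint is_path v s : bool :=
  if s is e :: s' then (src e == v) && is_path (rng e) s' else true.

(* The pair (v, [::]) is the trivial path p_v; a nontrivial path e_1 ... e_n is
   (src e_1, [:: e_1; ...; e_n]), so the first component is redundant for it. *)
Definition qpath := {p : vert E * seq (arr E) | is_path p.1 p.2}.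
HB.instance Definition _ := SubChoice.on qpath.

Implicit Types p : qpath.

Definition parrs p : seq (arr E) := (val p).2.
Definition plen p : nat := size (parrs p).
Definition pend v s : vert E := last v (map rng s).
Definition psrc p : vert E := (val p).1.
Definition prng p : vert E := pend (psrc p) (parrs p).

Lemma is_path_cat v s t :
  is_path v (s ++ t) = is_path v s && is_path (pend v s) t.
Proof. by elim: s v => //= e s IHs v; rewrite IHs andbA. Qed.

Lemma is_path_take k v s : is_path v s -> is_path v (take k s).
Proof. by rewrite -{1}(cat_take_drop k s) is_path_cat => /andP[]. Qed.

Lemma is_path_drop k v s :
  is_path v s -> is_path (pend v (take k s)) (drop k s).
Proof. by rewrite -{1}(cat_take_drop k s) is_path_cat => /andP[]. Qed.

Lemma is_path_arrow e : is_path (src e) [:: e].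
Proof. by rewrite /= eqxx. Qed.

Definition ptriv v : qpath := exist _ (v, [::]) isT.
Definition parrow e : qpath := exist _ (src e, [:: e]) (is_path_arrow e).

Definition pcat p q : option qpath :=
  if prng p == psrc q then insub (psrc p, parrs p ++ parrs q) else None.

(* For 0 <= k <= plen p these enumerate the factorizations of p as a
   concatenation of two paths (see pcat_splitP). *)
Definition ptake k p : qpath :=
  exist _ (psrc p, take k (parrs p)) (is_path_take k (valP p)).
Definition pdrop k p : qpath :=
  exist _ (pend (psrc p) (take k (parrs p)), drop k (parrs p))
    (is_path_drop k (valP p)).

Lemma qpath_inj p q : psrc p = psrc q -> parrs p = parrs q -> p = q.
Proof.
case: p q => [[v s] vs] [[w t] wt]; rewrite /psrc /parrs /= => vw st.
by apply: val_inj; rewrite /= vw st.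
Qed.

Lemma pcat_splitP p q r :
  pcat p q = Some r <->
  exists2 k, (k <= plen r)%N & p = ptake k r /\ q = pdrop k r.
Proof.
split.
  rewrite /pcat; case: eqP => // pq; case: insubP => // u _ uE [<-].
  have uS : psrc u = psrc p by rewrite /psrc uE.
  have uA : parrs u = parrs p ++ parrs q by rewrite {1}/parrs uE.
  exists (plen p); first by rewrite /plen uA size_cat leq_addr.
  split; apply: qpath_inj => //.
  - by rewrite {2}/parrs /= uA take_size_cat.
  - by rewrite {2}/psrc /= uA take_size_cat // uS.
  - by rewrite {2}/parrs /= uA drop_size_cat.
case=> k _ [-> ->]; rewrite /pcat.
rewrite /prng /psrc /parrs /= eqxx cat_take_drop.
by rewrite insubT ?(valP r) // => h; congr Some; apply: qpath_inj.
Qed.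

Lemma size_ptake k p : (k <= plen p)%N -> plen (ptake k p) = k.
Proof. by move=> kp; rewrite /plen /parrs /= size_takel. Qed.

Lemma size_pdrop k p : plen (pdrop k p) = (plen p - k)%N.
Proof. by rewrite /plen /parrs /= size_drop. Qed.

Lemma pend_cat v s t : pend v (s ++ t) = pend (pend v s) t.
Proof. by rewrite /pend map_cat last_cat. Qed.

Lemma ptake_ptake j i p : (j <= i)%N -> ptake j (ptake i p) = ptake j p.
Proof.
by move=> ji; apply: qpath_inj => //; rewrite /parrs /= take_takel.
Qed.

Lemma pdrop_ptake j i p :
  (j <= i)%N -> pdrop j (ptake i p) = ptake (i - j) (pdrop j p).
Proof.
move=> ji; apply: qpath_inj; rewrite /psrc /parrs /=.
  by rewrite take_takel.
by rewrite take_drop subnK.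
Qed.

Lemma pdrop_pdrop k j p : pdrop k (pdrop j p) = pdrop (k + j) p.
Proof.
apply: qpath_inj; rewrite /psrc /parrs /=; last by rewrite drop_drop.
by rewrite -pend_cat; congr pend; rewrite addnC takeD.
Qed.

Lemma ptake0 p : ptake 0 p = ptriv (psrc p).
Proof. by apply: qpath_inj; rewrite /psrc /parrs //= take0. Qed.

Lemma pdrop0 p : pdrop 0 p = p.
Proof. by apply: qpath_inj; rewrite /psrc /parrs /= ?take0 ?drop0. Qed.

Lemma ptake_plen p : ptake (plen p) p = p.
Proof. by apply: qpath_inj; rewrite /psrc /parrs //= take_size. Qed.

Lemma plen_pdrop_all p : plen (pdrop (plen p) p) = 0%N.
Proof. by rewrite size_pdrop subnn. Qed.

End Paths.

Arguments ptriv {E} v.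
Arguments parrow {E} e.

Section PowerSeries.
Variables (K : fieldType) (E : quiver).

(* P((E)). The linear structure is the pointwise one; the product is not. *)
Definition pseries := qpath E -> K.
HB.instance Definition _ := Choice.copy pseries (qpath E -> K).
HB.instance Definition _ := GRing.Lmodule.copy pseries (qpath E -> K^o).

Implicit Types f g h : pseries.

Lemma psD f g p : (f + g) p = f p + g p. Proof. by []. Qed.
Lemma psZ (a : K) f p : (a *: f) p = a * f p. Proof. by []. Qed.

Definition ps_one : pseries := fun p => (plen p == 0%N)%:R.
Definition ps_mul f g : pseries :=
  fun p => \sum_(k < (plen p).+1) f (ptake k p) * g (pdrop k p).

Fact ps_mulA : associative ps_mul.
Proof.
move=> f g h; apply/funext => p; rewrite /ps_mul.
pose F j i := f (ptake j p) * (g (ptake (i - j) (pdrop j p)) * h (pdrop i p)).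
transitivity (\sum_(j < (plen p).+1) \sum_(i < (plen p).+1 | (j <= i)%N) F j i).
  apply: eq_bigr => j _; rewrite size_pdrop big_distrr /=.
  have jp : (j <= plen p)%N by rewrite -ltnS.
  rewrite -(big_geq_mkord j _ predT (F j)).
  have := big_addn 0 (plen p).+1 j predT (F j); rewrite add0n => ->.
  rewrite subSn // big_mkord; apply: eq_bigr => k _.
  by rewrite /F addnK pdrop_pdrop.
rewrite (exchange_big_dep predT) //=; apply: eq_bigr => i _.
have ip : (i <= plen p)%N by rewrite -ltnS.
rewrite size_ptake // big_distrl /= (big_ord_narrow_leq ip).
apply: eq_bigr => j _ /=; have ji : (j <= i)%N by rewrite -ltnS.
by rewrite /F ptake_ptake // pdrop_ptake // mulrA.
Qed.

Fact ps_mul1l : left_id ps_one ps_mul.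
Proof.
move=> f; apply/funext => p; rewrite /ps_mul /ps_one big_ord_recl big1 /=.
  by rewrite size_ptake // pdrop0 mul1r addr0.
by move=> i _; rewrite size_ptake ?mul0r // lift0.
Qed.

Fact ps_mul1r : right_id ps_one ps_mul.
Proof.
move=> f; apply/funext => p; rewrite /ps_mul /ps_one big_ord_recr big1 /=.
  by rewrite plen_pdrop_all ptake_plen mulr1 add0r.
by move=> i _; rewrite size_pdrop subn_eq0 leqNgt ltn_ord mulr0.
Qed.

Fact ps_mulDl : left_distributive ps_mul +%R.
Proof.
move=> f g h; apply/funext => p; rewrite psD /ps_mul -big_split.
by apply: eq_bigr => i _; rewrite psD mulrDl.
Qed.

Fact ps_mulDr : right_distributive ps_mul +%R.
Proof.
move=> f g h; apply/funext => p; rewrite psD /ps_mul -big_split.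
by apply: eq_bigr => i _; rewrite psD mulrDr.
Qed.

HB.instance Definition _ := GRing.Zmodule_isPzRing.Build pseries
  ps_mulA ps_mul1l ps_mul1r ps_mulDl ps_mulDr.

Lemma psM f g p :
  (f * g) p = \sum_(k < (plen p).+1) f (ptake k p) * g (pdrop k p).
Proof. by []. Qed.

Lemma ps_scaleAl (a : K) f g : a *: (f * g) = a *: f * g.
Proof.
apply/funext => p; rewrite psZ !psM mulr_sumr.
by apply: eq_bigr => i _; rewrite psZ mulrA.
Qed.

Lemma ps_scaleAr (a : K) f g : a *: (f * g) = f * (a *: g).
Proof.
apply/funext => p; rewrite psZ !psM mulr_sumr.
by apply: eq_bigr => i _; rewrite psZ mulrCA.
Qed.

Definition ps_path (p : qpath E) : pseries := fun q => (q == p)%:R.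

(* Membership in the path algebra P(E), seen inside P((E)). *)
Definition finitely_supported f : Prop := finite_set [set p | f p != 0].

Lemma ps_path_finite p : finitely_supported (ps_path p).
Proof.
apply: (@sub_finite_set _ _ [set p]); last exact: finite_set1.
by move=> q; rewrite /= /ps_path; case: (q =P p) => // _; rewrite eqxx.
Qed.

Definition ltrans (e : arr E) f : pseries :=
  fun p => if pcat p (parrow e) is Some q then f q else 0.
Definition rtrans (e : arr E) f : pseries :=
  fun p => if pcat (parrow e) p is Some q then f q else 0.

Definition invertible_in (B : {pred pseries}) f : Prop :=
  exists2 g, g \in B & f * g = 1 /\ g * f = 1.

Definition inversion_closed (R : {pred pseries}) : Prop :=
  {in R, forall f, invertible_in predT f -> invertible_in R f}.

(* The library's subalg_closed is reserved to nontrivial algebras, whereas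
   P((E)) = 0 when E has no vertices. *)
Definition subalgebra (R : {pred pseries}) : Prop :=
  [/\ 1 \in R, GRing.linear_closed R & GRing.mulr_2closed R].

Lemma ltrans_linear e : linear (ltrans e).
Proof.
move=> a f g; apply/funext => p; rewrite psD psZ /ltrans.
by case: pcat => //; rewrite mulr0 addr0.
Qed.

End PowerSeries.

Section Subalgebra.
Variables (K : fieldType) (E : quiver) (R : {pred pseries K E}).
Hypothesis Ralg : subalgebra R.

Definition subalg_type of subalgebra R : Type := {f : pseries K E | f \in R}.
Local Notation RT := (subalg_type Ralg).

Fact subalgebra_submod : GRing.submod_closed R.
Proof.
case: Ralg => R1 Rlin _; split=> //.
by have := Rlin (-1) _ _ R1 R1; rewrite scaleN1r addNr.
Qed.

Fact subalgebra_subring : GRing.subring_closed R.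
Proof.
case: Ralg => R1 Rlin RM; split=> // f g fR gR.
by have := Rlin (-1) _ _ gR fR; rewrite scaleN1r addrC.
Qed.

HB.instance Definition _ := SubChoice.on RT.
HB.instance Definition _ :=
  GRing.SubChoice_isSubPzRing.Build _ _ RT subalgebra_subring.
HB.instance Definition _ :=
  GRing.SubZmodule_isSubLmodule.Build _ _ _ RT subalgebra_submod.
End Subalgebra.

Section Endomorphisms.
Variables (K : pzRingType) (V : lmodType K).

(* End_K(V) with endomorphisms acting on the right: v(f * g) = (vf)g. *)
Definition endo := {linear V -> V}.
Implicit Types f g h : endo.

Definition eapp f (v : V) : V := f v.

Lemma endoP f g : (forall v, eapp f v = eapp g v) -> f = g.
Proof.
case: f g => [f [[mf] [sf]]] [g [[mg] [sg]]]; rewrite /eapp /= => fg.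
have {}fg : f = g by apply/funext.
by subst g; rewrite (Prop_irrelevance mf mg) (Prop_irrelevance sf sg).
Qed.

HB.instance Definition _ := gen_eqMixin endo.
HB.instance Definition _ := gen_choiceMixin endo.

Definition endo0 : endo := \0.
Definition endo1 : endo := idfun.
Definition endo_opp f : endo := \- f.
Definition endo_add f g : endo := f \+ g.
Definition endo_mul f g : endo := g \o f.

Fact endo_addA : associative endo_add.
Proof. by move=> f g h; apply: endoP => v; rewrite /eapp /= addrA. Qed.
Fact endo_addC : commutative endo_add.
Proof. by move=> f g; apply: endoP => v; rewrite /eapp /= addrC. Qed.
Fact endo_add0 : left_id endo0 endo_add.
Proof. by move=> f; apply: endoP => v; rewrite /eapp /= add0r. Qed.
Fact endo_addN : left_inverse endo0 endo_opp endo_add.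
Proof. by move=> f; apply: endoP => v; rewrite /eapp /= addNr. Qed.
HB.instance Definition _ :=
  GRing.isZmodule.Build endo endo_addA endo_addC endo_add0 endo_addN.

Fact endo_mulA : associative endo_mul.
Proof. by move=> f g h; apply: endoP. Qed.
Fact endo_mul1l : left_id endo1 endo_mul.
Proof. by move=> f; apply: endoP. Qed.
Fact endo_mul1r : right_id endo1 endo_mul.
Proof. by move=> f; apply: endoP. Qed.
Fact endo_mulDl : left_distributive endo_mul +%R.
Proof.
by move=> f g h; apply: endoP => v; rewrite /eapp /= raddfD.
Qed.
Fact endo_mulDr : right_distributive endo_mul +%R.
Proof. by move=> f g h; apply: endoP. Qed.
HB.instance Definition _ := GRing.Zmodule_isPzRing.Build endo
  endo_mulA endo_mul1l endo_mul1r endo_mulDl endo_mulDr.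
End Endomorphisms.

Section GeneratedSubring.
Variables (A : pzRingType) (G : set A).

Definition in_subring_gen : {pred A} := fun x =>
  `[< forall B : {pred A},
        GRing.subring_closed B -> (forall g, G g -> g \in B) -> x \in B >].

Fact in_subring_gen_closed : GRing.subring_closed in_subring_gen.
Proof.
split=> [|x y /asboolP xG /asboolP yG|x y /asboolP xG /asboolP yG];
  apply/asboolP => B clB GB; have [B1 Bsub Bmul] := clB; first exact: B1.
  by apply: Bsub; [apply: xG | apply: yG].
by apply: Bmul; [apply: xG | apply: yG].
Qed.

Definition subring_gen : Type := {x : A | x \in in_subring_gen}.
HB.instance Definition _ := SubChoice.on subring_gen.
HB.instance Definition _ :=
  GRing.SubChoice_isSubPzRing.Build _ _ subring_gen in_subring_gen_closed.

Fact mem_subring_gen x : G x -> x \in in_subring_gen.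
Proof. by move=> Gx; apply/asboolP => B _; apply. Qed.

Definition sgen x (Gx : G x) : subring_gen := exist _ x (mem_subring_gen Gx).
End GeneratedSubring.

Section QuotientByPrincipalIdeal.
Variables (A : pzRingType) (q : A).

(* The two-sided ideal AqA. *)
Definition in_ideal : {pred A} := fun x =>
  `[< exists n (a b : 'I_n -> A), x = \sum_(i < n) a i * q * b i >].

Fact in_ideal_zmod : GRing.zmod_closed in_ideal.
Proof.
split; first by apply/asboolP; exists 0%N, (fun=> 0), (fun=> 0); rewrite big_ord0.
move=> _ _ /asboolP[m [a [b ->]]] /asboolP[n [c [d ->]]]; apply/asboolP.
pose glue (u : 'I_m -> A) (v : 'I_n -> A) i :=
  match fintype.split i with inl j => u j | inr j => v j end.
exists (m + n)%N, (glue a (fun i => - c i)), (glue b d).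
rewrite big_split_ord /= -sumrN; congr (_ + _); apply: eq_bigr => i _.
  by rewrite /glue (unsplitK (inl i)).
by rewrite /glue (unsplitK (inr i)) !mulNr.
Qed.

HB.instance Definition _ := GRing.isZmodClosed.Build A in_ideal in_ideal_zmod.

Lemma in_idealMl a x : x \in in_ideal -> a * x \in in_ideal.
Proof.
move=> /asboolP[n [c [d ->]]]; apply/asboolP; exists n, (fun i => a * c i), d.
by rewrite mulr_sumr; apply: eq_bigr => i _; rewrite !mulrA.
Qed.

Lemma in_idealMr a x : x \in in_ideal -> x * a \in in_ideal.
Proof.
move=> /asboolP[n [c [d ->]]]; apply/asboolP; exists n, c, (fun i => d i * a).
by rewrite mulr_suml; apply: eq_bigr => i _; rewrite !mulrA.
Qed.

Definition quot_ring : Type := Quotient.quot in_ideal.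
HB.instance Definition _ := GRing.Zmodule.on quot_ring.
HB.instance Definition _ := EqQuotient.on quot_ring.

Definition qpi (x : A) : quot_ring := \pi_quot_ring x.

Lemma qpiP x y : qpi x = qpi y <-> x - y \in in_ideal.
Proof. by rewrite (Quotient.idealrBE in_ideal); split => [/eqP|/eqP]. Qed.

Fact qpiD x y : qpi (x + y) = qpi x + qpi y.
Proof. exact: (@Quotient.pi_add _ in_ideal). Qed.

Definition quot_mul (x y : quot_ring) : quot_ring := qpi (repr x * repr y).

Fact qpi_repr (x : quot_ring) : qpi (repr x) = x.
Proof. exact: reprK. Qed.

Fact quot_mulE x y : quot_mul (qpi x) (qpi y) = qpi (x * y).
Proof.
apply/qpiP; set x' := repr _; set y' := repr _.
have -> : x' * y' - x * y = (x' - x) * y' + x * (y' - y).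
  by rewrite mulrBl mulrBr addrA subrK.
rewrite rpredD //; [apply: in_idealMr | apply: in_idealMl].
  by apply/qpiP; rewrite qpi_repr.
by apply/qpiP; rewrite qpi_repr.
Qed.

Fact quot_mulA : associative quot_mul.
Proof.
move=> x y z; rewrite -(qpi_repr x) -(qpi_repr y) -(qpi_repr z).
by rewrite !quot_mulE mulrA.
Qed.
Fact quot_mul1l : left_id (qpi 1) quot_mul.
Proof. by move=> x; rewrite -(qpi_repr x) quot_mulE mul1r. Qed.
Fact quot_mul1r : right_id (qpi 1) quot_mul.
Proof. by move=> x; rewrite -(qpi_repr x) quot_mulE mulr1. Qed.
Fact quot_mulDl : left_distributive quot_mul +%R.
Proof.
move=> x y z; rewrite -(qpi_repr x) -(qpi_repr y) -(qpi_repr z).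
by rewrite -qpiD !quot_mulE mulrDl qpiD.
Qed.
Fact quot_mulDr : right_distributive quot_mul +%R.
Proof.
move=> x y z; rewrite -(qpi_repr x) -(qpi_repr y) -(qpi_repr z).
by rewrite -qpiD !quot_mulE mulrDr qpiD.
Qed.
HB.instance Definition _ := GRing.Zmodule_isPzRing.Build quot_ring
  quot_mulA quot_mul1l quot_mul1r quot_mulDl quot_mulDr.

Lemma qpiM x y : qpi (x * y) = qpi x * qpi y.
Proof. by rewrite -quot_mulE. Qed.

Lemma qpi_zmod_morphism : zmod_morphism qpi.
Proof.
move=> x y; apply: (addIr (qpi y)); rewrite -qpiD !subrK //.
Qed.
HB.instance Definition _ := GRing.isZmodMorphism.Build A quot_ring qpi
  qpi_zmod_morphism.
Lemma qpi_monoid_morphism : monoid_morphism qpi.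
Proof. by split=> // x y; apply: qpiM. Qed.
HB.instance Definition _ := GRing.isMonoidMorphism.Build A quot_ring qpi
  qpi_monoid_morphism.
End QuotientByPrincipalIdeal.

Section ProjectiveModules.
Variable A : pzRingType.

Definition finitely_generated (M : lmodType A) : Prop :=
  exists n (x : 'I_n -> M), forall m, exists a : 'I_n -> A,
    m = \sum_(i < n) a i *: x i.

Definition projective (M : lmodType A) : Prop :=
  forall (X Y : lmodType A) (g : {linear X -> Y}) (f : {linear M -> Y}),
    (forall y, exists x, g x = y) ->
    exists h : {linear M -> X}, forall m, g (h m) = f m.

Definition mk_linear (M N : lmodType A) (f : M -> N) (flin : linear f) :
    {linear M -> N} :=
  HB.pack_for {linear M -> N} f (GRing.isLinear.Build _ _ _ _ f flin).

Definition mod_iso (M N : lmodType A) : Prop :=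
  exists f : {linear M -> N}, bijective f.

Lemma mod_iso_refl M : mod_iso M M.
Proof. by exists (idfun : {linear M -> M}); apply: (@Bijective _ _ _ id). Qed.

Lemma mod_iso_sym M N : mod_iso M N -> mod_iso N M.
Proof.
move=> [f [g fK gK]].
have glin : linear g.
  by move=> a x y; apply: (can_inj fK); rewrite linearP !gK.
by exists (mk_linear glin); exists f.
Qed.

Lemma mod_iso_trans N M P : mod_iso M N -> mod_iso N P -> mod_iso M P.
Proof. by move=> [f fb] [g gb]; exists (g \o f); apply: bij_comp. Qed.

Lemma mod_iso_prod M M' N N' :
  mod_iso M M' -> mod_iso N N' -> mod_iso (M * N)%type (M' * N')%type.
Proof.
move=> [f [f' fK f'K]] [g [g' gK g'K]].
pose h (x : M * N) : M' * N' := (f x.1, g x.2).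
have hlin : linear h by move=> a x y; rewrite /h /= !linearP.
exists (mk_linear hlin).
apply: (@Bijective _ _ h (fun y => (f' y.1, g' y.2))) => -[x y].
  by rewrite /h /= fK gK.
by rewrite /h /= f'K g'K.
Qed.
End ProjectiveModules.

(* Right A-modules are the left modules over the converse ring A^c. *)
Record fgproj (A : pzRingType) := FGProj {
  fg_module :> lmodType A^c;
  fg_generated : finitely_generated fg_module;
  fg_projective : projective fg_module
}.

Section VMonoid.
Variable A : pzRingType.

Fact fg_zero : finitely_generated ('rV[A^c]_0 : lmodType A^c).
Proof. by exists 0%N, (fun=> 0) => m; exists (fun=> 0); apply/rowP; case. Qed.

Fact proj_zero : projective ('rV[A^c]_0 : lmodType A^c).
Proof.
move=> X Y g f _.
exists (\0 : {linear 'rV[A^c]_0 -> X}) => m.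
by rewrite /= linear0 (_ : m = 0) ?linear0 //; apply/rowP; case.
Qed.

Definition fgproj0 : fgproj A := FGProj fg_zero proj_zero.

Fact fg_prod (M N : lmodType A^c) :
  finitely_generated M -> finitely_generated N ->
  finitely_generated (M * N : lmodType A^c)%type.
Proof.
move=> [m [x xP]] [n [y yP]].
pose z i : M * N := match fintype.split i with
  | inl j => (x j, 0) | inr j => (0, y j) end.
exists (m + n)%N, z => -[u v]; have [a ->] := xP u; have [b ->] := yP v.
pose c i := match fintype.split i with inl j => a j | inr j => b j end.
exists c; rewrite big_split_ord /=.
have -> : \sum_(i < m) c (lshift n i) *: z (lshift n i) =
          (\sum_(i < m) a i *: x i, 0).
  elim/big_rec2: _ => // i s w _ ->; rewrite /c /z (unsplitK (inl i)).
  by congr pair; rewrite /= scaler0 addr0.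
have -> : \sum_(i < n) c (rshift m i) *: z (rshift m i) =
          (0, \sum_(i < n) b i *: y i).
  elim/big_rec2: _ => // i s w _ ->; rewrite /c /z (unsplitK (inr i)).
  by congr pair; rewrite /= scaler0 addr0.
by congr pair; rewrite /= ?addr0 ?add0r.
Qed.

Fact proj_prod (M N : lmodType A^c) :
  projective M -> projective N -> projective (M * N : lmodType A^c)%type.
Proof.
move=> projM projN X Y g f g_surj.
have f1lin : linear (fun m : M => f (m, 0)).
  move=> a x y; rewrite -linearP; congr (f _).
  by congr pair; rewrite /= scaler0 addr0.
have f2lin : linear (fun n : N => f (0, n)).
  move=> a x y; rewrite -linearP; congr (f _).
  by congr pair; rewrite /= scaler0 addr0.
have [h1 h1P] := projM X Y g (mk_linear f1lin) g_surj.
have [h2 h2P] := projN X Y g (mk_linear f2lin) g_surj.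
pose h (z : M * N) : X := h1 z.1 + h2 z.2.
have hlin : linear h.
  by move=> a x y; rewrite /h /= !linearP /= scalerDr addrACA.
exists (mk_linear hlin) => -[m n].
rewrite /= /h linearD h1P h2P /= -linearD.
by congr (f _); congr pair; rewrite /= ?addr0 ?add0r.
Qed.

Definition fgprojD (P Q : fgproj A) : fgproj A :=
  FGProj (fg_prod (fg_generated P) (fg_generated Q))
         (proj_prod (@fg_projective A P) (@fg_projective A Q)).

Definition iso_class (P : fgproj A) : fgproj A -> Prop :=
  fun Q => mod_iso P Q.

(* V(A) as a set of isomorphism classes. It lives in a universe too large to
   carry the library's nmodType structure, whence the explicit operations. *)
Definition Vmon := {C : fgproj A -> Prop | exists P, C = iso_class P}.

Definition Vcls (P : fgproj A) : Vmon :=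
  exist _ (iso_class P) (ex_intro _ P erefl).

Definition Vzero : Vmon := Vcls fgproj0.

Definition class_sum (C D : fgproj A -> Prop) : fgproj A -> Prop :=
  fun N => exists P Q, [/\ C P, D Q & mod_iso (fgprojD P Q) N].

Lemma class_sumE P Q :
  class_sum (iso_class P) (iso_class Q) = iso_class (fgprojD P Q).
Proof.
apply/funext => N; apply/propext; split.
  move=> [P' [Q' [PP' QQ' PQN]]]; apply: mod_iso_trans PQN.
  exact: mod_iso_prod.
by move=> PQN; exists P, Q; split=> //; apply: mod_iso_refl.
Qed.

Fact class_sum_subproof (C D : Vmon) :
  exists P, class_sum (sval C) (sval D) = iso_class P.
Proof.
have [P ->] := svalP C; have [Q ->] := svalP D.
by exists (fgprojD P Q); apply: class_sumE.
Qed.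

Definition Vadd (C D : Vmon) : Vmon := exist _ _ (class_sum_subproof C D).

Lemma Vmon_inj (C D : Vmon) : sval C = sval D -> C = D.
Proof.
by case: C D => [C hC] [D hD] /= CD; subst D; rewrite (Prop_irrelevance hC hD).
Qed.

Lemma Vcls_surj (C : Vmon) : exists P, C = Vcls P.
Proof. by case: C => C [P CP]; exists P; apply: Vmon_inj. Qed.

Lemma VclsP (P Q : fgproj A) : Vcls P = Vcls Q <-> mod_iso P Q.
Proof.
split=> [[PQ]|PQ].
  by rewrite -/(iso_class P Q) PQ; apply: mod_iso_refl.
apply: Vmon_inj; apply/funext => N; apply/propext; split=> /= h.
  exact: mod_iso_trans (mod_iso_sym PQ) h.
exact: mod_iso_trans PQ h.
Qed.

Lemma Vadd_cls (P Q : fgproj A) : Vadd (Vcls P) (Vcls Q) = Vcls (fgprojD P Q).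
Proof. by apply: Vmon_inj; apply: class_sumE. Qed.

Lemma VaddC : commutative Vadd.
Proof.
move=> C D; have [P ->] := Vcls_surj C; have [Q ->] := Vcls_surj D.
rewrite !Vadd_cls; apply/VclsP.
pose h (x : P * Q) : Q * P := (x.2, x.1).
have hlin : linear h by [].
exists (mk_linear hlin).
by apply: (@Bijective _ _ h (fun x => (x.2, x.1))); case.
Qed.

Lemma VaddA : associative Vadd.
Proof.
move=> C D F; have [P ->] := Vcls_surj C; have [Q ->] := Vcls_surj D.
have [N ->] := Vcls_surj F; rewrite !Vadd_cls; apply/VclsP.
pose h (x : P * (Q * N)) : P * Q * N := (x.1, x.2.1, x.2.2).
have hlin : linear h by [].
exists (mk_linear hlin).
apply: (@Bijective _ _ h (fun x => (x.1.1, (x.1.2, x.2)))); first by case=> ? [].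
by case=> [[]].
Qed.

Lemma Vadd0 : left_id Vzero Vadd.
Proof.
move=> C; have [P ->] := Vcls_surj C; rewrite Vadd_cls; apply/VclsP.
pose h (x : 'rV[A^c]_0 * P) : P := x.2.
have hlin : linear h by [].
exists (mk_linear hlin).
apply: (@Bijective _ _ h (fun x => (0, x))) => // -[u x] /=.
by congr pair; apply/rowP; case.
Qed.
End VMonoid.

Section RightIdeal.
Variables (A : pzRingType) (e : A).

(* The right ideal eA as a right A-module, inside (A^c)^o, that is A acting on
   itself by right multiplication. *)
Definition in_right_ideal : {pred (A^c)^o} := fun x =>
  `[< exists t : A, x = e * t :> A >].

Fact right_ideal_submod : GRing.submod_closed in_right_ideal.
Proof.
split; first by apply/asboolP; exists 0; rewrite mulr0.
move=> a x y /asboolP[t xE] /asboolP[u yE]; apply/asboolP.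
by exists (t * a + u); rewrite mulrDr mulrA -xE -yE.
Qed.

Definition right_ideal : Type := {x : (A^c)^o | x \in in_right_ideal}.
HB.instance Definition _ := SubChoice.on right_ideal.
HB.instance Definition _ :=
  GRing.SubChoice_isSubLmodule.Build _ _ _ right_ideal right_ideal_submod.

Fact mem_right_ideal : e \in in_right_ideal.
Proof. by apply/asboolP; exists 1; rewrite mulr1. Qed.

Hypothesis idem_e : e * e = e.

Let e0 : right_ideal := exist _ e mem_right_ideal.

Fact right_ideal_gen (x : right_ideal) : x = (val x : A^c) *: e0.
Proof.
apply: val_inj; have /asboolP[t xE] := valP x.
change (val x = e * val x :> A).
by rewrite [in RHS]xE mulrA idem_e.
Qed.

Fact fg_right_ideal : finitely_generated (right_ideal : lmodType A^c).
Proof.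
exists 1%N, (fun=> e0) => x; exists (fun=> val x); rewrite big_ord1.
exact: right_ideal_gen.
Qed.

Fact proj_right_ideal : projective (right_ideal : lmodType A^c).
Proof.
move=> X Y g f g_surj; have [x0 x0E] := g_surj (f e0).
pose h (x : right_ideal) : X := (val x : A^c) *: x0.
have hlin : linear h.
  by move=> a x y; rewrite /h GRing.valD GRing.valZ scalerDl scalerA.
exists (mk_linear hlin) => x.
by rewrite /= /h linearZ /= x0E -linearZ /= -right_ideal_gen.
Qed.

Definition fg_right : fgproj A := FGProj fg_right_ideal proj_right_ideal.
End RightIdeal.

Section SkewRing.
Variables (K : fieldType) (E : quiver) (R : {pred pseries K E}).
Hypothesis Ralg : subalgebra R.
Hypothesis RPE : forall f, finitely_supported f -> f \in R.
Hypothesis Rltrans : forall e, {in R, forall f, ltrans e f \in R}.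

Local Notation RT := (subalg_type Ralg).

Fact rmul_linear (r : RT) : linear (fun x : RT => x * r).
Proof.
by move=> a x y; rewrite mulrDl; congr (_ + _); apply: val_inj;
  rewrite GRing.valM !GRing.valZ GRing.valM ps_scaleAl.
Qed.
Definition rmul (r : RT) : endo RT := mk_linear (rmul_linear r).

Definition delta_fun (e : arr E) (x : RT) : RT :=
  exist _ (ltrans e (val x)) (Rltrans e (valP x)).
Fact delta_linear e : linear (delta_fun e).
Proof.
by move=> a x y; apply: val_inj; apply: (@ltrans_linear K E e a).
Qed.
Definition delta (e : arr E) : endo RT := mk_linear (delta_linear e).

Definition skew_generators : set (endo RT) :=
  [set f | (exists r, f = rmul r) \/ (exists e, f = delta e)].

(* S = R<Ebar; tau, delta>; the generator \overline e is the operator delta e,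
   and tau only enters through the relations these operators satisfy. *)
Definition skew_ring : Type := subring_gen skew_generators.
HB.instance Definition _ := GRing.PzRing.on skew_ring.

Definition skew_of (r : RT) : skew_ring :=
  @sgen _ skew_generators (rmul r) (or_introl (ex_intro _ r erefl)).
Definition skew_bar (e : arr E) : skew_ring :=
  @sgen _ skew_generators (delta e) (or_intror (ex_intro _ e erefl)).

Definition path_in (p : qpath E) : RT :=
  exist _ (ps_path K p) (RPE (ps_path_finite K p)).

Definition skew_vertex (v : vert E) : skew_ring := skew_of (path_in (ptriv v)).
Definition skew_arrow (e : arr E) : skew_ring := skew_of (path_in (parrow e)).

Definition skew_q (i : vert E) : skew_ring :=
  skew_vertex i - \sum_(e : arr E | rng e == i) skew_bar e * skew_arrow e.

Definition skew_qtot : skew_ring :=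
  \sum_(i : vert E | [exists e : arr E, rng e == i]) skew_q i.

(* T = S/SqS *)
Definition quiver_ring : Type := quot_ring skew_qtot.
HB.instance Definition _ := GRing.PzRing.on quiver_ring.

Definition quiver_vertex (v : vert E) : quiver_ring :=
  qpi skew_qtot (skew_vertex v).

Lemma path_in_idem v : path_in (ptriv v) * path_in (ptriv v) = path_in (ptriv v).
Proof.
apply: val_inj; rewrite GRing.valM /=; apply/funext => p; rewrite psM /ps_path.
rewrite big_ord_recl big1 ?addr0 => [|i _].
  rewrite pdrop0 ptake0; case: (p =P ptriv v) => [->|_]; last by rewrite mulr0.
  by rewrite eqxx mulr1.
case: eqP => [/(congr1 (@plen E))|]; last by rewrite mul0r.
by rewrite size_ptake // lift0.
Qed.

Lemma quiver_vertex_idem v :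
  quiver_vertex v * quiver_vertex v = quiver_vertex v.
Proof.
rewrite /quiver_vertex -qpiM; congr qpi; apply: val_inj.
rewrite GRing.valM /=; apply: endoP => x.
change (x * path_in (ptriv v) * path_in (ptriv v) = x * path_in (ptriv v)).
by rewrite -mulrA path_in_idem.
Qed.

(* p_v T *)
Definition vertex_module (v : vert E) : fgproj quiver_ring :=
  fg_right (quiver_vertex_idem v).
End SkewRing.

Section GraphMonoid.
Variable E : quiver.

Definition free_monoid := {ffun vert E -> nat}.
HB.instance Definition _ := GRing.Nmodule.on free_monoid.

Definition fvertex (v : vert E) : free_monoid := [ffun w => nat_of_bool (w == v)].

Inductive graph_cong : free_monoid -> free_monoid -> Prop :=
| gc_rel v : [exists e : arr E, rng e == v] ->
    graph_cong (fvertex v) (\sum_(e : arr E | rng e == v) fvertex (src e))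
| gc_refl x : graph_cong x x
| gc_sym x y : graph_cong x y -> graph_cong y x
| gc_trans y x z : graph_cong x y -> graph_cong y z -> graph_cong x z
| gc_add x x' y y' : graph_cong x x' -> graph_cong y y' ->
    graph_cong (x + y) (x' + y').

Definition gcb : rel free_monoid := fun x y => `[< graph_cong x y >].

Fact gcb_equiv : equiv_class_of gcb.
Proof.
split=> [x|x y|y x z].
- exact/asboolP/gc_refl.
- by apply/asboolP/asboolP => /gc_sym.
- by move=> /asboolP xy /asboolP yz; apply/asboolP/(gc_trans xy yz).
Qed.
Canonical gcb_eqrel := EquivRelPack gcb_equiv.
Canonical gcb_encModRel := defaultEncModRel gcb.

Definition graph_monoid : Type := {eq_quot gcb}.
HB.instance Definition _ := Choice.on graph_monoid.
HB.instance Definition _ := EqQuotient.on graph_monoid.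

Definition gpi (x : free_monoid) : graph_monoid := \pi_graph_monoid x.

Lemma gpiP x y : gpi x = gpi y <-> graph_cong x y.
Proof.
split; first by move/eqP; rewrite /gpi piE => /asboolP.
by move=> xy; apply/eqP; rewrite /gpi piE; apply/asboolP.
Qed.

Fact gpi_repr (x : graph_monoid) : gpi (repr x) = x.
Proof. exact: reprK. Qed.

Definition gm_add (x y : graph_monoid) : graph_monoid := gpi (repr x + repr y).

Fact gm_addE x y : gm_add (gpi x) (gpi y) = gpi (x + y).
Proof. by apply/gpiP/gc_add; apply/gpiP; rewrite gpi_repr. Qed.

Fact gm_addA : associative gm_add.
Proof.
move=> x y z; rewrite -(gpi_repr x) -(gpi_repr y) -(gpi_repr z).
by rewrite !gm_addE addrA.
Qed.
Fact gm_addC : commutative gm_add.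
Proof. by move=> x y; rewrite /gm_add addrC. Qed.
Fact gm_add0 : left_id (gpi 0) gm_add.
Proof. by move=> x; rewrite -(gpi_repr x) gm_addE add0r. Qed.
HB.instance Definition _ :=
  GRing.isNmodule.Build graph_monoid gm_addA gm_addC gm_add0.

Definition gvertex (v : vert E) : graph_monoid := gpi (fvertex v).
End GraphMonoid.

(* Main.v *)
From HB Require Import structures.
Require Import Defs.
From mathcomp Require Import all_boot all_algebra.
From mathcomp Require Import boolp classical_sets functions cardinality.

Set Implicit Arguments.
Unset Strict Implicit.
Unset Printing Implicit Defensive.

(** Write e^- for the arrow of the inverse quiver opposite to e. In T one has e
    e^- = p_(src e), e f^- = 0 for distinct arrows e and f, and p_v is the sum
    of the products e^- e over the arrows e with range v as soon as there is one
    ([quiver_arrow_bar], [quiver_bar_arrow]). So p_v T is isomorphic to the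
    direct sum of the modules p_(src e) T over these arrows, and v |-> p_v T
    induces a morphism from the graph monoid to V(T).

    It is bijective because homomorphisms between standard modules, that is,
    between finite direct sums of modules p_v T, can be diagonalized.
    - Left multiplication by long enough paths carries any element of T into R
      ([reach_total]). Replacing summands of the target of a homomorphism X by
      means of the isomorphisms above, which does not change the class of the
      target in the graph monoid, thus turns X into a matrix over R
      ([expand_homogeneous]).
    - Let M be a nonzero matrix over R. If an entry has a nonzero constant term
      at a vertex u, then this entry is invertible in p_u R p_u, because R is
      closed under inversion, and Gaussian elimination splits off a common
      summand p_u T of the source and the target ([pivot_regular_cong]).
      Otherwise M is the product of the matrix M' of the left transductions of
      the entries of M, which involve shorter paths, and of the isomorphism that
      replaces each summand p_v T of the source by the modules p_(src e) T
      ([column_expansionE]). Rows are never added, so the procedure ends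
      ([homogeneous_regular_cong]): M becomes an identity block bordered by
      zeros, and when M is invertible over T its source and target have the same
      class in the graph monoid.

    A finitely generated projective module is the image of an idempotent matrix
    over T; the first step writes it as an isomorphism times a matrix over R,
    and the second one shows that its image is standard. This is surjectivity.
    For injectivity both steps are applied to an isomorphism of standard
    modules. There one needs that p_v is nonzero in T ([quiver_vertex_neq0]): q
    only sees constant terms at vertices that are not sources, so an element of
    the ideal annihilates, in R, all sufficiently long paths and all paths that
    start at a source. Some of these end at v, and p_v fixes them. *)

Import GRing.Theory.

Local Open Scope ring_scope.

(** * Projective modules as images of idempotent matrices *)

Section Matrices.
Variable A : pzRingType.

(** Any finite types serve as indices, so that sums and products of index types
    can be used without reindexing by ordinals. *)
Definition mat (I J : finType) : Type := I -> J -> A.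

Definition mmul (I J H : finType) (X : mat I J) (Y : mat J H) : mat I H :=
  fun i h => \sum_j X i j * Y j h.

Local Notation "X ** Y" := (mmul X Y) (at level 40, left associativity).

Lemma matP (I J : finType) (X Y : mat I J) :
  (forall i j, X i j = Y i j) -> X = Y.
Proof. by move=> XY; apply/funext => i; apply/funext => j. Qed.

Lemma mmulA (I J H L : finType) (X : mat I J) (Y : mat J H) (Z : mat H L) :
  X ** (Y ** Z) = X ** Y ** Z.
Proof.
apply: matP => i l; rewrite /mmul.
under eq_bigr do rewrite mulr_sumr.
rewrite exchange_big; apply: eq_bigr => h _.
by rewrite mulr_suml; apply: eq_bigr => j _; rewrite mulrA.
Qed.

HB.instance Definition _ (I J : finType) :=
  GRing.Zmodule.copy (mat I J) (I -> J -> A).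

Lemma mmulBl (I J H : finType) (X Y : mat I J) (Z : mat J H) :
  (X - Y) ** Z = X ** Z - Y ** Z.
Proof.
apply: matP => i h; rewrite /mmul.
change (\sum_j (X i j - Y i j) * Z j h =
        \sum_j X i j * Z j h - \sum_j Y i j * Z j h).
by rewrite -sumrB; apply: eq_bigr => j _; rewrite mulrBl.
Qed.

Lemma mmulBr (I J H : finType) (X : mat I J) (Y Z : mat J H) :
  X ** (Y - Z) = X ** Y - X ** Z.
Proof.
apply: matP => i h; rewrite /mmul.
change (\sum_j X i j * (Y j h - Z j h) =
        \sum_j X i j * Y j h - \sum_j X i j * Z j h).
by rewrite -sumrB; apply: eq_bigr => j _; rewrite mulrBr.
Qed.

(** Murray-von Neumann equivalence: when e and f are idempotent, eXf and fYe are
    mutually inverse isomorphisms between their images. *)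
Definition equivalent (I J : finType) (e : mat I I) (f : mat J J) : Prop :=
  exists X : mat I J, exists Y : mat J I, X ** Y = e /\ Y ** X = f.

Lemma equivalent_trans (I J H : finType) (e : mat I I) (f : mat J J)
    (g : mat H H) :
  e ** e = e -> g ** g = g -> equivalent e f -> equivalent f g ->
  equivalent e g.
Proof.
move=> ee gg [X [Y [XY YX]]] [Z [W [ZW WZ]]].
exists (X ** Z), (W ** Y); split.
  by rewrite !mmulA -(mmulA X) ZW -YX mmulA XY -mmulA XY ee.
by rewrite !mmulA -(mmulA W) YX -ZW mmulA WZ -mmulA WZ gg.
Qed.

Definition mapply (I J : finType) (X : mat I J) (x : J -> A) : I -> A :=
  fun i => \sum_j X i j * x j.

Lemma mapplyA (I J H : finType) (X : mat I J) (Y : mat J H) (x : H -> A) :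
  mapply X (mapply Y x) = mapply (X ** Y) x.
Proof.
apply/funext => i; rewrite /mapply /mmul.
under eq_bigr do rewrite mulr_sumr.
rewrite exchange_big; apply: eq_bigr => h _.
by rewrite mulr_suml; apply: eq_bigr => j _; rewrite mulrA.
Qed.

Lemma mapply_linear (I J : finType) (X : mat I J) (c : A^c)
    (x y : J -> (A^c)^o) :
  mapply X (c *: x + y) = c *: (mapply X x : I -> (A^c)^o) + mapply X y.
Proof.
apply/funext => i.
rewrite /mapply.
change (\sum_j X i j * ((x j : A) * c + y j) =
  (\sum_j X i j * x j) * c + \sum_j X i j * y j :> A).
rewrite mulr_suml -big_split /=; apply: eq_bigr => j _.
by rewrite mulrDr mulrA.
Qed.

Section Image.
Variables (I : finType) (e : mat I I).

Definition in_image : {pred I -> (A^c)^o} := fun x => `[< mapply e x = x >].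

Fact image_submod : GRing.submod_closed in_image.
Proof.
split=> [|c x y /asboolP xE /asboolP yE]; apply/asboolP.
  by apply/funext => i; apply: big1 => j _; apply: mulr0.
by rewrite mapply_linear xE yE.
Qed.

Definition image_mod : Type := {x : I -> (A^c)^o | x \in in_image}.
HB.instance Definition _ := SubChoice.on image_mod.
HB.instance Definition _ :=
  GRing.SubChoice_isSubLmodule.Build _ _ _ image_mod image_submod.

Definition coords (x : image_mod) : I -> A := val x.

Lemma coords_inj : injective coords.
Proof. exact: val_inj. Qed.

Lemma coords_sum (H : finType) (F : H -> image_mod) i :
  coords (\sum_h F h) i = \sum_h coords (F h) i.
Proof.
by apply: (big_morph (fun x => coords x i)).
Qed.

Lemma coordsP (x : image_mod) : mapply e (coords x) = coords x.
Proof. exact/asboolP/(valP x). Qed.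

Definition of_coords (x : I -> A) (xE : mapply e x = x) : image_mod :=
  exist _ (x : I -> (A^c)^o) (asboolT xE).

Hypothesis idem_e : e ** e = e.

Fact col_subproof (i : I) : mapply e (fun k => e k i) = (fun k => e k i).
Proof. by apply/funext => k; rewrite -[in RHS]idem_e. Qed.

Definition image_col (i : I) : image_mod := of_coords (col_subproof i).

Lemma image_sum (x : image_mod) :
  x = \sum_i (coords x i : A^c) *: image_col i.
Proof.
apply: coords_inj; rewrite -[LHS]coordsP; apply/funext => k.
by rewrite coords_sum.
Qed.

Fact fg_image : finitely_generated (image_mod : lmodType A^c).
Proof.
exists #|I|, (fun k => image_col (enum_val k)) => x.
exists (fun k => coords x (enum_val k)); rewrite {1}[x]image_sum.
by rewrite (reindex _ (onW_bij _ (@enum_val_bij I))).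
Qed.

Fact proj_image : projective (image_mod : lmodType A^c).
Proof.
move=> X Y g f g_surj.
have /choice[lift liftE] : forall i, exists z, g z = f (image_col i).
  by move=> i; apply: g_surj.
pose h (x : image_mod) : X := \sum_i (coords x i : A^c) *: lift i.
have hlin : linear h.
  move=> c x y; rewrite /h scaler_sumr -big_split /=; apply: eq_bigr => i _.
  by rewrite scalerA -scalerDl.
exists (mk_linear hlin) => x.
rewrite /= /h linear_sum [in RHS](image_sum x) linear_sum /=.
by apply: eq_bigr => i _; rewrite !linearZ /= liftE.
Qed.

Definition fg_image_mod : fgproj A := FGProj fg_image proj_image.
End Image.

(** The two matrices of an equivalence act as mutually inverse maps between the
    images; conversely the images of the columns of e under an isomorphism, and
    those of the columns of f under its inverse, form such a pair. *)
Lemma image_iso (I J : finType) (e : mat I I) (f : mat J J)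
    (ee : e ** e = e) (ff : f ** f = f) :
  mod_iso (fg_image_mod ee) (fg_image_mod ff) <-> equivalent e f.
Proof.
split.
  move=> [F [G FK GK]].
  have Glin : linear G.
    by move=> c x y; apply: (can_inj FK); rewrite linearP !GK.
  have [H HG] : exists H : {linear fg_image_mod ff -> fg_image_mod ee}, H =1 G.
    by exists (mk_linear Glin).
  pose Y : mat J I := fun j i => coords (F (image_col ee i)) j.
  pose X : mat I J := fun i j => coords (H (image_col ff j)) i.
  have FE (x : fg_image_mod ee) : coords (F x) = mapply Y (coords x).
    rewrite {1}[x](image_sum ee) linear_sum /=; apply/funext => j.
    by rewrite coords_sum; apply: eq_bigr => i _; rewrite linearZ.
  have GE (x : fg_image_mod ff) : coords (H x) = mapply X (coords x).
    rewrite {1}[x](image_sum ff) linear_sum /=.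
    apply/funext => j; rewrite coords_sum; apply: eq_bigr => i _.
    by rewrite linearZ.
  exists X, Y; split; apply: matP => i j.
    by rewrite -[RHS]/(coords (image_col ee j) i) -[image_col ee j]FK -HG GE.
  by rewrite -[RHS]/(coords (image_col ff j) i) -[image_col ff j]GK -HG FE.
move=> [X [Y [XY YX]]].
have YE x : mapply e x = x -> mapply f (mapply Y x) = mapply Y x.
  by move=> xE; rewrite mapplyA -YX -mmulA XY -mapplyA xE.
have XE x : mapply f x = x -> mapply e (mapply X x) = mapply X x.
  by move=> xE; rewrite mapplyA -XY -mmulA YX -mapplyA xE.
pose F (x : fg_image_mod ee) : fg_image_mod ff := of_coords (YE _ (coordsP x)).
pose G (x : fg_image_mod ff) : fg_image_mod ee := of_coords (XE _ (coordsP x)).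
have Flin : linear F.
  move=> c x y; apply: coords_inj.
  exact: (mapply_linear Y c (coords x) (coords y)).
exists (mk_linear Flin); exists G => x; apply: coords_inj.
  by rewrite /= [coords _]mapplyA XY coordsP.
by rewrite /= [coords _]mapplyA YX coordsP.
Qed.

(** A surjection from a free module onto N and a section of it compose to an
    idempotent matrix. *)
Lemma fgproj_image (N : fgproj A) :
  exists n (e : mat 'I_n 'I_n) (ee : e ** e = e), mod_iso N (fg_image_mod ee).
Proof.
have [n [x xP]] := fg_generated N; exists n.
pose g (c : 'I_n -> (A^c)^o) : N := \sum_i (c i : A^c) *: x i.
have glin : linear g.
  move=> a b c; rewrite /g scaler_sumr -big_split /=; apply: eq_bigr => i _.
  by rewrite scalerA -scalerDl.
have [y|h hK] :=
    @fg_projective A N _ _ (mk_linear glin) (idfun : {linear N -> N}).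
  by have [c yE] := xP y; exists c.
have gh z : g (h z) = z by apply: hK.
pose e : mat 'I_n 'I_n := fun i j => h (x j) i.
have hE z : mapply e z = h (g z).
  rewrite /g linear_sum; apply/funext => i; rewrite fct_sumE.
  by apply: eq_bigr => j _; rewrite linearZ.
have ee : e ** e = e.
  apply: matP => i j.
  by rewrite -[RHS]/(h (x j) i) -[x j in RHS]gh -hE.
have hP (m : N) : mapply e (h m) = h m by rewrite hE gh.
exists e, ee; pose F (m : N) : fg_image_mod ee := of_coords (hP m).
have Flin : linear F.
  by move=> c u v; apply: coords_inj; rewrite /F /coords /= linearP.
exists (mk_linear Flin); exists (fun z => g (coords z)) => z.
  exact: gh.
by apply: coords_inj; rewrite -[RHS]coordsP hE.
Qed.
End Matrices.

Local Notation "X ** Y" := (mmul X Y) (at level 40, left associativity).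

(** * Standard modules *)

Section DiagonalIdempotents.
Variables (A : pzRingType) (L : Type) (p : L -> A).

Definition diag (I : finType) (a : I -> L) : mat A I I :=
  fun i j => if i == j then p (a i) else 0.

Lemma diag_mmul (I J : finType) (a : I -> L) (X : mat A I J) i j :
  (diag a ** X) i j = p (a i) * X i j.
Proof.
rewrite /mmul (bigD1 i) //= /diag eqxx big1 ?addr0 // => k.
by rewrite eq_sym => /negPf->; rewrite mul0r.
Qed.

Lemma mmul_diag (I J : finType) (b : J -> L) (X : mat A I J) i j :
  (X ** diag b) i j = X i j * p (b j).
Proof.
rewrite /mmul (bigD1 j) //= /diag eqxx big1 ?addr0 // => k /negPf->.
by rewrite mulr0.
Qed.

Lemma mapply_diag (I : finType) (a : I -> L) x :
  mapply (diag a) x = fun i => p (a i) * x i.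
Proof.
apply/funext => i; rewrite /mapply (bigD1 i) //= /diag eqxx big1 ?addr0 // => k.
by rewrite eq_sym => /negPf->; rewrite mul0r.
Qed.

Hypothesis p_idem : forall l, p l * p l = p l.

Lemma diag_idem (I : finType) (a : I -> L) : diag a ** diag a = diag a.
Proof.
apply: matP => i j; rewrite diag_mmul /diag.
by case: eqP; rewrite ?mulr0 ?p_idem.
Qed.

Definition standard (I : finType) (a : I -> L) : fgproj A :=
  fg_image_mod (diag_idem a).

Definition sum_label (I J : finType) (a : I -> L) (b : J -> L)
    (k : (I + J)%type) : L :=
  match k with inl i => a i | inr j => b j end.

Lemma standard_sum (I J : finType) (a : I -> L) (b : J -> L) :
  mod_iso (standard (sum_label a b)) (fgprojD (standard a) (standard b)).
Proof.
have lP (x : standard (sum_label a b)) :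
    mapply (diag a) (fun i => coords x (inl i)) = fun i => coords x (inl i).
  by rewrite -[in RHS](coordsP x) !mapply_diag.
have rP (x : standard (sum_label a b)) :
    mapply (diag b) (fun i => coords x (inr i)) = fun i => coords x (inr i).
  by rewrite -[in RHS](coordsP x) !mapply_diag.
pose join (y : I -> A) (z : J -> A) k :=
  match k with inl i => y i | inr j => z j end.
have jP (y : standard a) (z : standard b) :
    mapply (diag (sum_label a b)) (join (coords y) (coords z)) =
    join (coords y) (coords z).
  rewrite -[in RHS](coordsP y) -[in RHS](coordsP z) !mapply_diag.
  by apply/funext; case.
pose F x : fgprojD (standard a) (standard b) :=
  (of_coords (lP x), of_coords (rP x)).
have Flin : linear F by move=> c x y; congr pair; apply: coords_inj.
exists (mk_linear Flin).
exists (fun y => of_coords (jP y.1 y.2)) => [x|[y z]].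
  by apply: coords_inj; apply/funext; case.
by congr pair; apply: coords_inj.
Qed.

Lemma standard_void (a : void -> L) : mod_iso (standard a) (fgproj0 A).
Proof.
exists \0; exists (fun=> 0) => x; last by apply/rowP; case.
by apply: coords_inj; apply/funext; case.
Qed.

Lemma standard_unit (l : L) (l_idem : p l * p l = p l) :
  mod_iso (standard (fun _ : unit => l)) (fg_right l_idem).
Proof.
have Fin (x : standard (fun _ : unit => l)) :
    (coords x tt : (A^c)^o) \in in_right_ideal (p l).
  apply/asboolP; exists (coords x tt).
  by rewrite -[in LHS](coordsP x) mapply_diag.
have Gin (y : fg_right l_idem) :
    mapply (diag (fun _ : unit => l)) (fun=> val y : A) = fun=> val y : A.
  rewrite mapply_diag; apply/funext => _.
  by have /asboolP[t ->] := valP y; rewrite mulrA l_idem.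
pose F (x : standard (fun _ : unit => l)) : fg_right l_idem :=
  exist _ (coords x tt : (A^c)^o) (Fin x).
have Flin : linear F by move=> c x y; apply: val_inj.
exists (mk_linear Flin); exists (fun y => of_coords (Gin y)) => x.
  by apply: coords_inj; apply/funext; case.
exact: val_inj.
Qed.

End DiagonalIdempotents.

Section Weights.
Variable E : quiver.
Local Notation label := (option (vert E)).

(** The label None stands for a zero summand: rows and columns can then be
    discarded without changing the index type. *)
Definition label_weight (o : label) : free_monoid E :=
  if o is Some v then fvertex v else 0.

Definition weight (I : finType) (a : I -> label) : free_monoid E :=
  \sum_i label_weight (a i).

Lemma weight_card (I : finType) (a : I -> label) v :
  weight a v = #|[pred i | a i == Some v]|.
Proof.
rewrite /weight sum_ffunE -sum1_card [RHS]big_mkcond /=; apply: eq_bigr => i _.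
rewrite inE; case: (a i) => [w|]; last by rewrite ffunE.
by rewrite /= ffunE eq_sym; case: eqP => [->|nvw]; rewrite ?eqxx //;
  case: eqP => // -[].
Qed.

Lemma weight_sum (I J : finType) (a : I -> label) (b : J -> label) :
  weight (sum_label a b) = weight a + weight b.
Proof. by rewrite /weight big_sumType. Qed.

Definition canonical_label (x : free_monoid E) (k : {v : vert E & 'I_(x v)}) :
  label := Some (tag k).

Lemma weight_canonical (x : free_monoid E) : weight (@canonical_label x) = x.
Proof.
apply/ffunP => v; rewrite /weight sum_ffunE.
transitivity (\sum_w \sum_(k < x w) (fvertex w v)).
  rewrite sig_big_dep /=; apply: eq_bigr => -[w k] _ //.
rewrite (bigD1 v) //= [X in _ + X]big1 => [|w nwv].
  by rewrite addr0 /fvertex ffunE eqxx [LHS]sum1_card card_ord.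
by rewrite big1 // => k _; rewrite /fvertex ffunE eq_sym (negPf nwv).
Qed.

Section Relabel.
Variables (A : pzRingType) (p : label -> A).
Hypothesis p_idem : forall l, p l * p l = p l.
Hypothesis p_None : p None = 0.

(* The k-th index labelled v in one family is paired with the k-th index
   labelled v in the other. *)
Let rank (I : finType) (a : I -> label) i :=
  index i (enum [pred k | a k == a i]).
Let paired (I J : finType) (a : I -> label) (b : J -> label) i j :=
  (a i == b j) && (rank a i == rank b j).

Let pairedC (I J : finType) (a : I -> label) (b : J -> label) i j :
  paired a b i j = paired b a j i.
Proof. by rewrite /paired eq_sym [rank b j == _]eq_sym. Qed.

Let paired_inj (I J : finType) (a : I -> label) (b : J -> label) i j j' :
  paired a b i j -> paired a b i j' -> j = j'.
Proof.
move=> /andP[/eqP ab /eqP r] /andP[/eqP ab' /eqP r'].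
have bb : b j' = b j by rewrite -ab'.
have jF : j \in enum [pred k | b k == b j] by rewrite mem_enum inE.
have j'F : j' \in enum [pred k | b k == b j] by rewrite mem_enum inE bb.
rewrite -(nth_index j jF) -(nth_index j j'F).
by move: r'; rewrite r /rank bb => ->.
Qed.

Let paired_ex (I J : finType) (a : I -> label) (b : J -> label) i :
  weight a = weight b -> a i != None -> exists j, paired a b i j.
Proof.
case ai: (a i) => [v|] // ab _.
have lt : (rank a i < size (enum [pred k | b k == Some v]))%N.
  by rewrite -cardE -weight_card -ab weight_card cardE /rank ai index_mem
    mem_enum inE ai.
have [j0 _] : exists j0, j0 \in enum [pred k | b k == Some v].
  by case: (enum _) lt => // j0 s _; exists j0; rewrite mem_head.
pose j := nth j0 (enum [pred k | b k == Some v]) (rank a i).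
have bj : b j = Some v.
  by apply/eqP; have := mem_nth j0 lt; rewrite mem_enum inE.
exists j; rewrite /paired ai bj eqxx /=.
by rewrite [rank b j]/rank bj index_uniq ?enum_uniq.
Qed.

(** The pairing of indices with equal labels is a permutation matrix up to the
    rows and columns labelled None. *)
Lemma relabel (I J : finType) (a : I -> label) (b : J -> label) :
  weight a = weight b -> equivalent (diag p a) (diag p b).
Proof.
have half (I' J' : finType) (c : I' -> label) (d : J' -> label) :
    weight c = weight d ->
    (fun i j => if paired c d i j then p (c i) else 0) **
    (fun j i => if paired d c j i then p (d j) else 0) = diag p c.
  move=> cd; apply: matP => i i'; rewrite /mmul /diag.
  case: (eqVneq (c i) None) => [ci|ci].
    rewrite big1 => [|j _]; first by rewrite ci p_None if_same.
    by rewrite ci p_None if_same mul0r.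
  have [j ij] := paired_ex cd ci; rewrite (bigD1 j) //= ij big1 => [|k nkj].
    rewrite addr0; case: eqP => [<-|nii].
      by rewrite pairedC ij; have /andP[/eqP<- _] := ij; rewrite p_idem.
    case: ifP; rewrite ?mulr0 // => ji'; case: nii.
    by apply: paired_inj ji'; rewrite pairedC.
  case: ifP => [ik|]; last by rewrite mul0r.
  by case/eqP: nkj; apply: paired_inj ik ij.
move=> ab.
exists (fun i j => if paired a b i j then p (a i) else 0).
exists (fun j i => if paired b a j i then p (b j) else 0).
by split; apply: half.
Qed.
End Relabel.
End Weights.

(** * Formal power series *)

Section Series.
Variables (K : fieldType) (E : quiver).
Implicit Types (f g h : pseries K E) (p q r : qpath E).
Implicit Types (e : arr E) (v w : vert E).

Local Notation pv v := (ps_path K (ptriv v)).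
Local Notation pa e := (ps_path K (parrow e)).

Lemma ps_mul_path f r q :
  (f * ps_path K r) q =
  if (plen r <= plen q)%N && (pdrop (plen q - plen r) q == r)
  then f (ptake (plen q - plen r) q) else 0.
Proof.
rewrite psM /ps_path; case: ifP => [/andP[rq /eqP dr]|/negP nrq].
  have lt : (plen q - plen r < (plen q).+1)%N by rewrite ltnS leq_subr.
  rewrite (bigD1 (Ordinal lt)) //= dr eqxx mulr1 big1 ?addr0 // => k nk.
  case: eqP => [kr|]; last by rewrite mulr0.
  case/eqP: nk; apply: val_inj; rewrite /= -kr size_pdrop subKn //.
  by rewrite -ltnS.
apply: big1 => k _; case: eqP => [kr|]; last by rewrite mulr0.
have kq : (k <= plen q)%N by rewrite -ltnS.
by case: nrq; rewrite -kr size_pdrop leq_subr subKn //= kr.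
Qed.

Lemma ps_path_mul f r q :
  (ps_path K r * f) q =
  if (plen r <= plen q)%N && (ptake (plen r) q == r)
  then f (pdrop (plen r) q) else 0.
Proof.
rewrite psM /ps_path; case: ifP => [/andP[rq /eqP dr]|/negP nrq].
  have lt : (plen r < (plen q).+1)%N by rewrite ltnS.
  rewrite (bigD1 (Ordinal lt)) //= dr eqxx mul1r big1 ?addr0 // => k nk.
  case: eqP => [kr|]; last by rewrite mul0r.
  case/eqP: nk; apply: val_inj; rewrite /= -kr size_ptake //.
  by rewrite -ltnS.
apply: big1 => k _; case: eqP => [kr|]; last by rewrite mul0r.
have kq : (k <= plen q)%N by rewrite -ltnS.
by case: nrq; rewrite -kr size_ptake // kq eqxx.
Qed.

Lemma pdrop_plen q : pdrop (plen q) q = ptriv (prng q).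
Proof.
by apply: qpath_inj; rewrite /psrc /parrs /= ?take_size ?drop_size.
Qed.

Lemma ptriv_inj : injective (@ptriv E).
Proof. by move=> v w [->]. Qed.

Lemma parrow_inj : injective (@parrow E).
Proof. by move=> e e' []. Qed.

Lemma ps_mul_vertex f v q : (f * pv v) q = if prng q == v then f q else 0.
Proof.
rewrite ps_mul_path /= subn0 pdrop_plen ptake_plen.
by rewrite (inj_eq ptriv_inj).
Qed.

Lemma ps_vertex_mul f v q : (pv v * f) q = if psrc q == v then f q else 0.
Proof. by rewrite ps_path_mul /= pdrop0 ptake0 (inj_eq ptriv_inj). Qed.

Lemma plen0 p : plen p = 0%N -> p = ptriv (psrc p).
Proof. by move=> p0; rewrite -ptake0 -p0 ptake_plen. Qed.

Lemma pcat_arrowP p e : prng p = src e ->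
  exists q, [/\ pcat p (parrow e) = Some q, plen q = (plen p).+1,
                ptake (plen p) q = p, pdrop (plen p) q = parrow e &
                prng q = rng e].
Proof.
move=> pe; rewrite /pcat pe eqxx.
have qP : is_path (psrc p) (parrs p ++ parrs (parrow e)).
  by rewrite is_path_cat (valP p) /= -/(prng p) pe eqxx.
rewrite (@insubT _ _ _ (psrc p, parrs p ++ parrs (parrow e)) qP).
eexists; split; first by [].
- by rewrite /plen /parrs /= size_cat addn1.
- by apply: qpath_inj; rewrite /psrc /parrs //= take_size_cat.
- apply: qpath_inj; rewrite /psrc /parrs /=.
    by rewrite take_size_cat // -/(prng p).
  by rewrite drop_size_cat.
- by rewrite /prng /psrc /parrs /= pend_cat.
Qed.

Lemma pcat_arrow_None p e : prng p != src e -> pcat p (parrow e) = None.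
Proof. by rewrite /pcat => /negPf ->. Qed.

Lemma path_last q k : plen q = k.+1 ->
  exists e, pcat (ptake k q) (parrow e) = Some q /\ pdrop k q = parrow e.
Proof.
move=> qk; have : plen (pdrop k q) = 1%N by rewrite size_pdrop qk subSnn.
have := valP (pdrop k q); rewrite -/(psrc _) -/(parrs _) /plen.
case dE : (parrs _) => [|e [|]] //= /andP[/eqP es _] _.
have dP : pdrop k q = parrow e by apply: qpath_inj.
exists e; split=> //; apply/pcat_splitP; exists k; first by rewrite qk.
by rewrite dP.
Qed.

Lemma psrc_cat p e q : pcat p (parrow e) = Some q -> psrc q = psrc p.
Proof. by move=> /pcat_splitP[k _ [-> _]]. Qed.

Lemma ltrans_mul_arrow f e e' :
  ltrans e (f * pa e') = if e == e' then f * pv (src e) else 0.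
Proof.
apply/funext => p; rewrite /ltrans.
have [pe|pe] := eqVneq (prng p) (src e); last first.
  rewrite pcat_arrow_None //; case: eqP => // _.
  by rewrite ps_mul_vertex (negPf pe).
have [q [-> ql tq dq _]] := pcat_arrowP pe.
rewrite ps_mul_path ql subSS subn0 dq tq (inj_eq parrow_inj) /=.
by case: eqP => // _; rewrite ps_mul_vertex pe eqxx.
Qed.

Lemma ltrans_mul_vertex f e : ltrans e f * pv (src e) = ltrans e f.
Proof.
apply/funext => p; rewrite ps_mul_vertex.
by case: eqP => // /eqP pe; rewrite /ltrans pcat_arrow_None.
Qed.

Lemma ltrans_vertex f e v :
  ltrans e (f * pv v) = if rng e == v then ltrans e f else 0.
Proof.
apply/funext => p; rewrite /ltrans.
have [pe|pe] := eqVneq (prng p) (src e); last first.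
  by case: ifP; rewrite // /ltrans pcat_arrow_None.
have [q [qE ql tq dq qr]] := pcat_arrowP pe; rewrite qE.
by rewrite ps_mul_vertex qr; case: eqP => // _; rewrite qE.
Qed.

Lemma vertex_ltrans f e v : pv v * ltrans e f = ltrans e (pv v * f).
Proof.
apply/funext => p; rewrite ps_vertex_mul /ltrans.
case pq: pcat => [q|]; last by rewrite if_same.
by rewrite ps_vertex_mul (psrc_cat pq).
Qed.

Lemma vertex_orth v w : pv v * pv w = if v == w then pv v else 0.
Proof.
apply/funext => p; rewrite ps_vertex_mul /ps_path.
case: (eqVneq p (ptriv w)) => [->|pw]; rewrite /psrc /=.
  by case: (eqVneq w v) => [->|]; rewrite ?eqxx // eq_sym => /negPf->.
rewrite if_same; case: ifP => // /eqP vw; by rewrite vw (negPf pw).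
Qed.

Lemma arrow_vertex e : pa e * pv (rng e) = pa e.
Proof.
apply/funext => p; rewrite ps_mul_vertex /ps_path.
by case: (eqVneq p (parrow e)) => [->|_]; rewrite ?eqxx // if_same.
Qed.

(** Every path is trivial or ends in exactly one arrow. *)
Lemma series_expansion f :
  f = \sum_v f (ptriv v) *: pv v + \sum_e ltrans e f * pa e.
Proof.
apply/funext => q; rewrite psD !fct_sumE.
have vE v : (f (ptriv v) *: pv v) q = if q == ptriv v then f q else 0.
  by rewrite psZ /ps_path; case: eqP => [->|]; rewrite ?mulr1 ?mulr0.
rewrite (eq_bigr _ (fun v _ => vE v)).
case ql : (plen q) => [|k].
  rewrite (bigD1 (psrc q)) //= -plen0 // eqxx [X in _ + X + _]big1 => [|v].
    rewrite big1 ?addr0 // => e _.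
    by rewrite ps_mul_path ql.
  by move=> nv; case: eqP => // qv; rewrite qv eqxx in nv.
have [e [qE dE]] := path_last ql.
rewrite [X in X + _]big1 => [|v _]; last first.
  by case: eqP => // qv; move: ql; rewrite qv.
rewrite add0r (bigD1 e) //= big1 => [|e' nee].
  by rewrite addr0 ps_mul_path ql /= subSS subn0 dE eqxx /ltrans qE.
rewrite ps_mul_path ql /= subSS subn0 dE.
by rewrite (inj_eq parrow_inj) eq_sym (negPf nee).
Qed.

Lemma ltrans_coef f q k : plen q = k.+1 -> f q != 0 ->
  exists e p, [/\ plen p = k, ltrans e f p = f q & rng e = prng q].
Proof.
move=> ql fq; have [e [qE dE]] := path_last ql; exists e, (ptake k q).
split; first by rewrite size_ptake // ql.
  by rewrite /ltrans qE.
have /eqP te : prng (ptake k q) == src e.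
  by move: qE; rewrite /pcat; case: ifP.
have [q' []] := pcat_arrowP te; rewrite qE => -[<-] _ _ _ -> //.
Qed.

(** The inverse of 1 - h is the geometric series of h: only the powers h^n with
    n <= |q| contribute to the coefficient of a path q. *)
Lemma geometric_inverse h : (forall v, h (ptriv v) = 0) ->
  exists g, (1 - h) * g = 1 /\ g * (1 - h) = 1.
Proof.
move=> h0.
have hn n : forall q, (plen q < n)%N -> (h ^+ n) q = 0.
  elim: n => // n IHn q qn; rewrite exprS psM; apply: big1 => k _.
  have kq : (k <= plen q)%N by rewrite -ltnS.
  case: (posnP k) => [->|k0]; first by rewrite ptake0 h0 mul0r.
  rewrite IHn ?mulr0 // size_pdrop.
  rewrite -ltnS; apply: leq_trans qn.
  by rewrite ltnS ltn_subrL k0 (leq_trans k0 kq).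
pose G n := \sum_(i < n) h ^+ i.
have GE n : forall q, (plen q < n)%N -> G n q = G (plen q).+1 q.
  move=> q; elim: n => // n IHn; rewrite ltnS leq_eqVlt => /orP[/eqP->//|qn].
  by rewrite /G big_ord_recr /= psD hn // addr0; apply: IHn.
pose g : pseries K E := fun q => G (plen q).+1 q.
have geo n : (1 - h) * G n = 1 - h ^+ n /\ G n * (1 - h) = 1 - h ^+ n.
  rewrite /G; elim: n => [|n [IHl IHr]].
    by rewrite big_ord0 mulr0 mul0r expr0 subrr.
  rewrite big_ord_recr /=; split.
    by rewrite mulrDr IHl mulrBl mul1r -exprS addrA subrK.
  by rewrite mulrDl IHr mulrBr mulr1 -exprSr addrA subrK.
exists g; split; apply/funext => q.
  transitivity (((1 - h) * G (plen q).+1) q).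
    rewrite !psM; apply: eq_bigr => k _; congr (_ * _).
    by rewrite /g -(GE (plen q).+1) // size_pdrop ltnS leq_subr.
  by rewrite (geo _).1 psD [X in _ + X](_ : _ = 0) ?addr0 //;
    rewrite -[(- _) q]/(- ((h ^+ (plen q).+1) q)) hn ?oppr0.
transitivity ((G (plen q).+1 * (1 - h)) q).
  rewrite !psM; apply: eq_bigr => k _; congr (_ * _).
  by rewrite /g -(GE (plen q).+1) // size_ptake // -ltnS.
by rewrite (geo _).2 psD [X in _ + X](_ : _ = 0) ?addr0 //;
  rewrite -[(- _) q]/(- ((h ^+ (plen q).+1) q)) hn ?oppr0.
Qed.

(** After multiplication by the inverse of its constant part, f has the form
    1 - h with h free of constant terms. *)
Lemma invertible_series f : (forall v, f (ptriv v) != 0) ->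
  invertible_in predT f.
Proof.
move=> f0.
pose c : pseries K E := fun q => if plen q == 0%N then (f q)^-1 else 0.
pose d : pseries K E := fun q => if plen q == 0%N then f q else 0.
have dmul (x y : pseries K E) q : (forall p, plen p != 0%N -> x p = 0) ->
    (x * y) q = x (ptriv (psrc q)) * y q.
  move=> x0; rewrite psM big_ord_recl big1 ?addr0 => [|k _].
    by rewrite ptake0 pdrop0.
  by rewrite x0 ?mul0r // size_ptake // lift0.
have cd : c * d = 1 /\ d * c = 1.
  split; apply/funext => q; rewrite dmul /c /d => [|p /negPf-> //] /=;
    change (1 q : K) with ((plen q == 0%N)%:R : K);
    case: eqP => [q0|]; rewrite ?mulr0 //; rewrite -(plen0 q0).
    by rewrite mulVf // (plen0 q0).
  by rewrite mulfV // (plen0 q0).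
have [v|g [gl gr]] := @geometric_inverse (1 - c * f).
  change ((1 - (c * f) (ptriv v)) = 0 :> K); rewrite dmul => [|p /negPf p0].
    by rewrite /c /= mulVf ?subrr.
  by rewrite /c p0.
rewrite opprB addrC subrK in gl gr.
exists (g * c) => //; split; last by rewrite -mulrA.
by rewrite -[f]mul1r -cd.2 -!mulrA (mulrA c) (mulrA (c * f)) gl mul1r.
Qed.
End Series.

(** * Corners and expansions in the subalgebra *)

Section SubalgebraOfSeries.
Variables (K : fieldType) (E : quiver) (R : {pred pseries K E}).
Hypothesis Ralg : subalgebra R.
Hypothesis RPE : forall f, finitely_supported f -> f \in R.
Hypothesis Rltrans : forall e, {in R, forall f, ltrans e f \in R}.

Local Notation RT := (subalg_type Ralg).
Local Notation label := (option (vert E)).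

Definition vertex (v : vert E) : RT := path_in Ralg RPE (ptriv v).
Definition arrow (e : arr E) : RT := path_in Ralg RPE (parrow e).
Definition lab (l : label) : RT := if l is Some v then vertex v else 0.
Local Notation delta := (@delta_fun K E R Ralg Rltrans).

Lemma vertex_mul v w : vertex v * vertex w = if v == w then vertex v else 0.
Proof. by apply: val_inj; rewrite [LHS]vertex_orth; case: eqP. Qed.

Lemma lab_idem l : lab l * lab l = lab l.
Proof. by case: l => [v|] /=; rewrite ?mulr0 // vertex_mul eqxx. Qed.

Lemma arrow_vertexR e : arrow e * vertex (rng e) = arrow e.
Proof. by apply: val_inj; apply: arrow_vertex. Qed.

Lemma arrow_lab e l : l != Some (rng e) -> arrow e * lab l = 0.
Proof.
case: l => [v|] /= vr; last by rewrite mulr0.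
rewrite -arrow_vertexR -mulrA vertex_mul.
case: eqP => [rv|]; last by rewrite mulr0.
by rewrite rv eqxx in vr.
Qed.

Lemma delta_vertexr e r : delta e r * vertex (src e) = delta e r.
Proof. by apply: val_inj; apply: ltrans_mul_vertex. Qed.

Lemma delta_vertexl e r v : vertex v * delta e r = delta e (vertex v * r).
Proof. by apply: val_inj; apply: vertex_ltrans. Qed.

Lemma delta_labl e r l : lab l * r = r -> lab l * delta e r = delta e r.
Proof.
case: l => [v|] /= rE; first by rewrite delta_vertexl rE.
have -> : r = 0 by rewrite -rE mul0r.
rewrite mul0r; apply: val_inj; apply/funext => p; rewrite /= /ltrans.
by case: pcat.
Qed.

Lemma lab_coef l (r : RT) v :
  lab l * r = r -> val r (ptriv v) != 0 -> l = Some v.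
Proof.
move=> <-; case: l => [w|] /=; last by rewrite mul0r eqxx.
change (((ps_path K (ptriv w) * val r) (ptriv v) != 0) -> Some w = Some v).
by rewrite ps_vertex_mul; case: ifP => [/eqP<-|] //; rewrite eqxx.
Qed.

Lemma coef_lab l (r : RT) p :
  r * lab l = r -> val r p != 0 -> l = Some (prng p).
Proof.
move=> <-; case: l => [w|] /=; last by rewrite mulr0 eqxx.
change (((val r * ps_path K (ptriv w)) p != 0) -> Some w = Some (prng p)).
by rewrite ps_mul_vertex; case: ifP => [/eqP<-|] //; rewrite eqxx.
Qed.

Lemma val_sum (I : finType) (F : I -> RT) : val (\sum_i F i) = \sum_i val (F i).
Proof. exact: (big_morph (fun x : RT => val x)). Qed.

Lemma subalgebra_expansion (r : RT) :
  r = \sum_v (val r (ptriv v)) *: vertex v + \sum_e delta e r * arrow e.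
Proof.
apply: val_inj; rewrite {1}[val r]series_expansion.
transitivity (val (\sum_v (val r (ptriv v)) *: vertex v) +
             val (\sum_e delta e r * arrow e)); last by [].
by rewrite !val_sum; congr (_ + _); apply: eq_bigr.
Qed.

Lemma arrow_expansion (r : RT) : (forall v, val r (ptriv v) = 0) ->
  r = \sum_e delta e r * arrow e.
Proof.
move=> r0; rewrite {1}[r]subalgebra_expansion big1 ?add0r // => v _.
by rewrite r0 scale0r.
Qed.

Lemma vertex_expansion (r : RT) i :
  vertex i * r = (val r (ptriv i)) *: vertex i +
                 \sum_e delta e (vertex i * r) * arrow e.
Proof.
rewrite {1}[vertex i * r]subalgebra_expansion; congr (_ + _).
have co v :
    val (vertex i * r) (ptriv v) = if v == i then val r (ptriv v) else 0.
  exact: ps_vertex_mul.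
rewrite (eq_bigr _ (fun v _ => congr1 (fun x => x *: vertex v) (co v))).
rewrite (bigD1 i) //= eqxx big1 ?addr0 // => v nvi.
by rewrite (negPf nvi) scale0r.
Qed.

Lemma arrow_mul_coef e (r : RT) v : val (arrow e * r) (ptriv v) = 0.
Proof. exact: ps_path_mul. Qed.

Lemma scale_vertex (c : K) v : c *: vertex v = (c *: (1 : RT) : RT) * vertex v.
Proof.
apply: val_inj.
by change (c *: ps_path K (ptriv v) =
  (c *: (1 : pseries K E) : pseries K E) * ps_path K (ptriv v));
  rewrite -ps_scaleAl mul1r.
Qed.

Lemma sum_vertex : \sum_v vertex v = 1.
Proof.
apply: val_inj; rewrite val_sum; apply/funext => q; rewrite fct_sumE.
change (\sum_v ps_path K (ptriv v) q = (plen q == 0%N)%:R :> K).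
case: eqP => [q0|q0]; last first.
  by apply: big1 => v _; rewrite /ps_path; case: eqP => // qv; rewrite qv in q0.
rewrite (bigD1 (psrc q)) //= /ps_path -plen0 // eqxx big1 ?addr0 // => v nv.
by case: eqP => // qv; rewrite qv eqxx in nv.
Qed.

Hypothesis Rinv : inversion_closed R.

(** Adding 1 - p_u to an element of the corner at u whose constant term is
    nonzero makes every constant term nonzero. *)
Lemma corner_inverse u (m : RT) :
  vertex u * m = m -> m * vertex u = m -> val m (ptriv u) != 0 ->
  exists n, m * n = vertex u /\ n * m = vertex u.
Proof.
move=> um mu m0; pose f : RT := m + (1 - vertex u).
have uf : vertex u * f = m.
  by rewrite /f mulrDr mulrBr mulr1 vertex_mul eqxx subrr addr0.
have fu : f * vertex u = m.
  by rewrite /f mulrDl mulrBl mul1r vertex_mul eqxx subrr addr0.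
have /(Rinv (valP f)) [g gR [fg gf]] : invertible_in predT (val f).
  apply: invertible_series => v.
  change (val m (ptriv v) + (1 - (ptriv v == ptriv u)%:R) != 0 :> K).
  rewrite (inj_eq (@ptriv_inj E)); case: (v =P u) => [->|vu].
    by rewrite subrr addr0.
  have -> : val m (ptriv v) = 0.
    apply/eqP; apply: contraT => /coef_lab-/(_ (Some u) mu)[uv].
    by rewrite uv in vu.
  by rewrite add0r subr0 oner_eq0.
pose g' : RT := exist _ g gR.
have fg' : f * g' = 1 by apply: val_inj.
have gf' : g' * f = 1 by apply: val_inj.
exists (vertex u * g' * vertex u); split.
- by rewrite !mulrA mu -uf -(mulrA _ f) fg' mulr1 vertex_mul eqxx.
- by rewrite -!mulrA um -fu (mulrA g') gf' mul1r vertex_mul eqxx.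
Qed.
End SubalgebraOfSeries.

(** * Reducing matrices over the extension to the subalgebra *)

Lemma graph_cong_sum (E : quiver) (I : finType) (F G : I -> free_monoid E) :
  (forall i, graph_cong (F i) (G i)) ->
  graph_cong (\sum_i F i) (\sum_i G i).
Proof.
move=> FG; elim/big_rec2: _ => [|i x y _ xy]; first exact: gc_refl.
exact: gc_add.
Qed.

(** The ring T is generated by the image of the subalgebra and by elements bar e
    subject to the Cuntz-Krieger relations. Together with the nonvanishing of
    the vertices, these properties of the quiver ring determine V(T). *)
Section CuntzKriegerExtension.
Variables (K : fieldType) (E : quiver) (R : {pred pseries K E}).
Hypothesis Ralg : subalgebra R.
Hypothesis RPE : forall f, finitely_supported f -> f \in R.
Hypothesis Rinv : inversion_closed R.
Hypothesis Rltrans : forall e, {in R, forall f, ltrans e f \in R}.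

Local Notation RT := (subalg_type Ralg).
Local Notation label := (option (vert E)).
Local Notation vertex := (@vertex K E R Ralg RPE).
Local Notation arrow := (@arrow K E R Ralg RPE).
Local Notation lab := (@lab K E R Ralg RPE).
Local Notation delta := (@delta_fun K E R Ralg Rltrans).

Variables (T : pzRingType) (emb : {rmorphism RT -> T}) (bar : arr E -> T).

Hypothesis range_bar : forall e, emb (vertex (rng e)) * bar e = bar e.
Hypothesis arrow_bar : forall e f,
  emb (arrow e) * bar f = if e == f then emb (vertex (src e)) else 0.
Hypothesis bar_arrow : forall v, [exists e : arr E, rng e == v] ->
  \sum_(e : arr E | rng e == v) bar e * emb (arrow e) = emb (vertex v).
Hypothesis T_ind : forall P : T -> Prop, P 1 ->
  (forall x y, P x -> P y -> P (x - y)) ->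
  (forall x y, P x -> P y -> P (x * y)) ->
  (forall r, P (emb r)) -> (forall e, P (bar e)) -> forall t, P t.
Hypothesis vertex_neq0 : forall v, emb (vertex v) <> 0.

Local Notation D := (diag (emb \o lab)).

Lemma elab_idem l : (emb \o lab) l * (emb \o lab) l = (emb \o lab) l.
Proof. by rewrite /= -rmorphM lab_idem. Qed.

Lemma elab_None : (emb \o lab) None = 0.
Proof. exact: rmorph0. Qed.

Lemma elab_eq0 l : emb (lab l) = 0 -> l = None.
Proof. by case: l => // v /vertex_neq0. Qed.

Definition entered (l : label) : bool := [exists e : arr E, l == Some (rng e)].

Lemma enteredP v : entered (Some v) = [exists e : arr E, rng e == v].
Proof.
by apply: eq_existsb => e; rewrite eq_sym; apply/eqP/eqP => [[]|->].
Qed.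

Lemma entered_rng e : entered (Some (rng e)).
Proof. by apply/existsP; exists e. Qed.

(** All products of t by paths of length n on the left, and by shorter paths
    that start at a source, lie in the subalgebra. Phrasing this by recursion on
    the last arrow avoids any manipulation of paths. *)
Fixpoint reach (n : nat) (t : T) : Prop :=
  if n is m.+1 then
    (forall e, reach m (emb (arrow e) * t)) /\
    (forall l, ~~ entered l -> reach m (emb (lab l) * t))
  else exists r, t = emb r.

Lemma reach0 n : reach n 0.
Proof.
elim: n => [|n IHn] /=; first by exists 0; rewrite rmorph0.
by split=> *; rewrite mulr0.
Qed.

Lemma reachB n t u : reach n t -> reach n u -> reach n (t - u).
Proof.
elim: n t u => [|n IHn] t u /=.
  by move=> [r ->] [s ->]; exists (r - s); rewrite rmorphB.
by move=> [ta tv] [ua uv]; split=> [e|l nl]; rewrite mulrBr;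
  apply: IHn; auto.
Qed.

Lemma reachD n t u : reach n t -> reach n u -> reach n (t + u).
Proof.
by move=> tn un; rewrite -[u]opprK -[- u]add0r; do 2?apply: reachB => //;
  apply: reach0.
Qed.

Lemma reach_sum n (I : finType) (F : I -> T) :
  (forall i, reach n (F i)) -> reach n (\sum_i F i).
Proof.
move=> FP; elim/big_rec: _ => [|i t _ tP]; first exact: reach0.
exact: reachD.
Qed.

(** Multiplying an element of the subalgebra by an arrow on the left annihilates
    its constant term, so that the product can again be expanded through the
    arrows on its right; at a vertex that no arrow enters, a scalar is left
    over. *)
Lemma reach_emb n r t : reach n t -> reach n (emb r * t).
Proof.
elim: n r t => [|n IHn] r t /=.
  by move=> [s ->]; exists (r * s); rewrite rmorphM.
move=> [ta tv].
have expand s : (forall v, val s (ptriv v) = 0) -> reach n (emb s * t).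
  move=> /(arrow_expansion RPE Rltrans) ->; rewrite rmorph_sum mulr_suml.
  by apply: reach_sum => e; rewrite rmorphM -mulrA; apply: IHn.
split=> [e|[v|] nl]; last by rewrite rmorph0 mul0r; apply: reach0.
  by rewrite mulrA -rmorphM; apply: expand => v; apply: arrow_mul_coef.
rewrite mulrA -rmorphM (vertex_expansion RPE Rltrans) rmorphD mulrDl.
apply: reachD.
  by rewrite scale_vertex rmorphM -mulrA; apply/IHn/(tv (Some v)).
rewrite rmorph_sum mulr_suml.
by apply: reach_sum => e; rewrite rmorphM -mulrA; apply: IHn.
Qed.

Lemma reachS n t : reach n t -> reach n.+1 t.
Proof. by split=> *; apply: reach_emb. Qed.

Lemma reach_leq n m t : (n <= m)%N -> reach n t -> reach m t.
Proof.
move=> /subnK <-; elim: (m - n)%N => // k IHk tn.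
by rewrite addSn; apply/reachS/IHk.
Qed.

Lemma reach_bar n e t : reach n t -> reach n.+1 (bar e * t).
Proof.
move=> tn; split=> [f|l nl]; rewrite mulrA.
  rewrite arrow_bar; case: eqP => _; first exact: reach_emb.
  by rewrite mul0r; apply: reach0.
rewrite -range_bar mulrA -rmorphM.
case: l nl => [v|] nl /=; last by rewrite mul0r rmorph0 !mul0r; apply: reach0.
rewrite vertex_mul; case: eqP => [ve|_].
  by rewrite ve entered_rng in nl.
by rewrite rmorph0 !mul0r; apply: reach0.
Qed.

(** The elements t such that every product t * u with u reachable is again
    reachable form a subring that contains the generators. *)
Lemma reach_total t : exists n, reach n t.
Proof.
suff /(_ 0%N 1) [|m] : forall n u, reach n u -> exists m, reach m (t * u).
- by exists 1; rewrite rmorph1.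
- by rewrite mulr1; exists m.
elim/T_ind: t => [|x y IHx IHy|x y IHx IHy|r|e] n u un.
- by exists n; rewrite mul1r.
- have [k xk] := IHx n u un; have [m ym] := IHy n u un.
  exists (maxn k m); rewrite mulrBl; apply: reachB.
    by apply: reach_leq xk; rewrite leq_maxl.
  by apply: reach_leq ym; rewrite leq_maxr.
- have [k yk] := IHy n u un; have [m xm] := IHx k _ yk.
  by exists m; rewrite -mulrA.
- by exists n; apply: reach_emb.
- by exists n.+1; apply: reach_bar.
Qed.

(** One expansion step replaces the summand of label Some v by the summands of
    labels Some (src e), for the arrows e with range v, if v is entered; it
    keeps a source, and this is the role of the extra index in unit. The
    matrices step_up and step_down are mutually inverse isomorphisms between the
    two. *)
Local Notation step := (arr E + unit)%type.

Definition step_label (l : label) (o : step) : label :=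
  match o with
  | inl e => if l == Some (rng e) then Some (src e) else None
  | inr _ => if entered l then None else l
  end.

Definition step_up (l : label) (o : step) : T :=
  match o with
  | inl e => if l == Some (rng e) then emb (arrow e) else 0
  | inr _ => if entered l then 0 else emb (lab l)
  end.

Definition step_down (l : label) (o : step) : T :=
  match o with
  | inl e => if l == Some (rng e) then bar e else 0
  | inr _ => if entered l then 0 else emb (lab l)
  end.

Lemma step_up_down l o o' :
  step_up l o * step_down l o' =
  if o == o' then emb (lab (step_label l o)) else 0.
Proof.
case: o o' => [e|[]] [e'|[]] /=.
- rewrite (inj_eq (@inl_inj _ _)); case: eqP => [->|_] /=.
    rewrite eq_sym; case: eqP => [[ee]|ne].
      by rewrite arrow_bar eq_sym.
    by rewrite mulr0; case: eqP => // ee; case: ne; rewrite ee.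
  by rewrite mul0r rmorph0 if_same.
- by case: eqP => [->|_]; rewrite ?entered_rng ?mulr0 ?mul0r.
- by case: eqP => [->|_]; rewrite ?entered_rng ?mulr0 ?mul0r.
- by case: ifP => _; rewrite ?mulr0 ?rmorph0 // elab_idem.
Qed.

Lemma step_down_up l : \sum_o step_down l o * step_up l o = emb (lab l).
Proof.
rewrite big_sumType /= [X in _ + X](big_pred1 tt) /=; last by case.
case: ifP => nl.
  case: l nl => [v|] nl; last by move/existsP: nl => [].
  rewrite mulr0 addr0 /= -bar_arrow -?enteredP // [RHS]big_mkcond.
  apply: eq_bigr => e _.
  have -> : (Some v == Some (rng e)) = (rng e == v).
    by rewrite eq_sym; apply/eqP/eqP => [[]|->].
  by case: eqP; rewrite ?mulr0.
rewrite big1 => [|e _]; first by rewrite add0r elab_idem.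
by case: eqP => [lE|]; [rewrite lE entered_rng in nl | rewrite mulr0].
Qed.

Lemma step_label_weight v : entered (Some v) ->
  \sum_o label_weight (step_label (Some v) o) =
  \sum_(e : arr E | rng e == v) fvertex (src e).
Proof.
move=> vX; rewrite big_sumType /= [X in _ + X](big_pred1 tt) /=; last by case.
rewrite vX addr0 [RHS]big_mkcond; apply: eq_bigr => e _.
have -> : (Some v == Some (rng e)) = (rng e == v).
  by rewrite eq_sym; apply/eqP/eqP => [[]|->].
by case: eqP.
Qed.

Lemma step_label_cong l :
  graph_cong (label_weight l) (\sum_o label_weight (step_label l o)).
Proof.
have [lX|nl] := boolP (entered l).
  case: l lX => [v|] vX; last by move/existsP: vX => [].
  by rewrite step_label_weight //; apply: gc_rel; rewrite -enteredP.
rewrite big_sumType /= [X in _ + X](big_pred1 tt) /=; last by case.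
rewrite (negPf nl) big1 ?add0r => [|e _]; first exact: gc_refl.
by case: eqP => // lE; rewrite lE entered_rng in nl.
Qed.

Section Expansion.
Variables (I : finType) (a : I -> label).

Definition expand (k : I * step) : label := step_label (a k.1) k.2.

Definition up : mat T (I * step)%type I :=
  fun k i => if k.1 == i then step_up (a i) k.2 else 0.
Definition down : mat T I (I * step)%type :=
  fun i k => if k.1 == i then step_down (a i) k.2 else 0.

Lemma up_mmul (J : finType) (X : mat T I J) k j :
  (up ** X) k j = step_up (a k.1) k.2 * X k.1 j.
Proof.
rewrite /mmul (bigD1 k.1) //= /up eqxx big1 ?addr0 // => i.
by rewrite eq_sym => /negPf ->; rewrite mul0r.
Qed.

Lemma mmul_up (J : finType) (X : mat T J (I * step)%type) j i :
  (X ** up) j i = \sum_o X j (i, o) * step_up (a i) o.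
Proof.
transitivity (\sum_i' \sum_o X j (i', o) * up (i', o) i).
  by rewrite pair_bigA; apply: eq_bigr => -[].
rewrite (bigD1 i) //= [X in _ + X]big1 ?addr0 => [|i' ni].
  by apply: eq_bigr => o _; rewrite /up eqxx.
by apply: big1 => o _; rewrite /up /= (negPf ni) mulr0.
Qed.

Lemma up_down : up ** down = D expand.
Proof.
apply: matP => -[i o] [i' o']; rewrite up_mmul /= /down /diag /= xpair_eqE.
rewrite eq_sym; case: eqP => [->|_]; last by rewrite mulr0.
exact: step_up_down.
Qed.

Lemma down_up : down ** up = D a.
Proof.
apply: matP => i i'; rewrite mmul_up /down /diag /=.
rewrite eq_sym; case: eqP => [->|_]; first exact: step_down_up.
by apply: big1 => o _; rewrite mul0r.
Qed.

Lemma expand_cong : graph_cong (weight a) (weight expand).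
Proof.
rewrite [weight expand](_ : _ =
    \sum_i \sum_o label_weight (step_label (a i) o)); last first.
  by rewrite pair_bigA.
by apply: graph_cong_sum => i; apply: step_label_cong.
Qed.
End Expansion.

Definition emb_mat (I J : finType) (M : mat RT I J) : mat T I J :=
  fun i j => emb (M i j).

Lemma emb_matM (I J H : finType) (M : mat RT I J) (N : mat RT J H) :
  emb_mat (M ** N) = emb_mat M ** emb_mat N.
Proof.
apply: matP => i j; rewrite /emb_mat /mmul rmorph_sum.
by apply: eq_bigr => k _; rewrite rmorphM.
Qed.

Lemma diag_emb (I : finType) (a : I -> label) : emb_mat (diag lab a) = D a.
Proof.
by apply: matP => i j; rewrite /emb_mat /diag; case: ifP; rewrite ?rmorph0.
Qed.

(** As the index types are finite, one depth n serves all the entries, and n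
    expansions of the rows bring them all down to the subalgebra. *)
Lemma expand_to_subalgebra (I J : finType) (a : I -> label) (X : mat T I J) :
  D a ** X = X ->
  exists (H : finType) (c : H -> label) (U : mat T H I) (U' : mat T I H)
    (M : mat RT H J),
    [/\ U ** U' = D c, U' ** U = D a, U ** X = emb_mat M &
        graph_cong (weight a) (weight c)].
Proof.
move=> aX; have [n nX] : exists n, forall i j, reach n (X i j).
  have /choice[f fP] : forall k : I * J, exists n, reach n (X k.1 k.2).
    by move=> k; apply: reach_total.
  exists (\max_k f k)%N => i j; apply: reach_leq (fP (i, j)).
  exact: (leq_bigmax (i, j)).
elim: n I a X aX nX => [|n IHn] I a X aX nX.
  have /choice[f fP] : forall k : I * J, exists r, X k.1 k.2 = emb r.
    by move=> k; apply: nX.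
  exists I, a, (D a), (D a), (fun i j => f (i, j)).
  rewrite aX !(diag_idem elab_idem); split=> //; last exact: gc_refl.
  by apply: matP => i j; rewrite (fP (i, j)).
have [||H [c [U [U' [M [UU' U'U UX ac]]]]]] :=
    IHn _ (expand a) (up a ** X).
- by rewrite -up_down -mmulA (mmulA _ (up a)) down_up aX.
- move=> [i o] j; rewrite up_mmul /=; case: o => [e|u] /=; case: ifP => nl;
    rewrite ?mul0r; do ?exact: reach0.
    exact: (nX i j).1.
  by apply: (nX i j).2; rewrite nl.
exists H, c, (U ** up a), (down a ** U'), M; split.
- rewrite mmulA -(mmulA U) up_down -U'U mmulA UU' -mmulA UU'.
  exact: (diag_idem elab_idem).
- rewrite mmulA -(mmulA _ U') U'U -up_down mmulA down_up -mmulA down_up.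
  exact: (diag_idem elab_idem).
- by rewrite -mmulA.
- exact: gc_trans (expand_cong a) ac.
Qed.

(** * Gaussian elimination *)

(** The matrix M represents a homomorphism between standard modules: it is
    unchanged by the diagonal idempotents of its target and its source. *)
Definition homogeneous (I J : finType) (a : I -> label) (b : J -> label)
    (M : mat RT I J) : Prop :=
  forall i j, lab (a i) * M i j = M i j /\ M i j * lab (b j) = M i j.

(** Von Neumann regularity, with quasi-inverse QP, where moreover the rank
    idempotent PMQ is standard: the image of M is then isomorphic to the
    standard module on c. *)
Definition regular (I J : finType) (M : mat T I J) : Prop :=
  exists (H : finType) (c : H -> label) (P : mat T H I) (Q : mat T J H),
    P ** M ** Q = D c /\ M ** Q ** P ** M = M.

Definition cong_of_invertible (I J : finType) (a : I -> label)
    (b : J -> label) (M : mat T I J) : Prop :=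
  forall Y : mat T J I, M ** Y = D a -> Y ** M = D b ->
    graph_cong (weight a) (weight b).

Lemma homogeneous_emb (I J : finType) (a : I -> label) (b : J -> label) M :
  homogeneous a b M -> D a ** emb_mat M = emb_mat M /\
                       emb_mat M ** D b = emb_mat M.
Proof.
move=> aMb; rewrite -!diag_emb -!emb_matM.
by split; congr emb_mat; apply: matP => i j;
  rewrite ?diag_mmul ?mmul_diag; case: (aMb i j).
Qed.

Lemma regular0 (I J : finType) : @regular I J 0.
Proof.
exists void, (of_void _), (fun h => of_void _ h), (fun _ h => of_void _ h).
split; first by apply: matP; case.
by apply: matP => i j; apply: big1 => k _; apply: mulr0.
Qed.

Lemma cong_of_invertible0 (I J : finType) (a : I -> label) (b : J -> label) :
  cong_of_invertible a b 0.
Proof.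
have weight0 (H : finType) (c : H -> label) : D c = 0 -> weight c = 0.
  move=> c0; apply: big1 => h _.
  have := congr1 (fun X => X h h) c0; rewrite /diag eqxx.
  by move/elab_eq0 => ->.
move=> Y aE bE; rewrite !weight0; first exact: gc_refl.
  by rewrite -bE; apply: matP => i j; apply: big1 => k _; apply: mulr0.
by rewrite -aE; apply: matP => i j; apply: big1 => k _; apply: mul0r.
Qed.

(** Expanding the columns of M: when no entry has a constant term, each entry is
    the sum over e of its left transduction by e times e, and only the arrows
    that end at the label of its column occur. The index of a column labelled by
    a source that is kept by the expansion carries 0, since the only path ending
    at a source is trivial. *)
Section ColumnExpansion.
Variables (I J : finType) (a : I -> label) (b : J -> label) (M : mat RT I J).
Hypothesis aMb : homogeneous a b M.

Definition column_expansion : mat RT I (J * step)%type :=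
  fun i k => match k.2 with
  | inl e => if b k.1 == Some (rng e) then delta e (M i k.1) else 0
  | inr _ => 0
  end.

Lemma column_expansion_homogeneous :
  homogeneous a (expand b) column_expansion.
Proof.
move=> i [j [e|u]]; rewrite /column_expansion /expand /=; last first.
  by rewrite mulr0 mul0r.
case: ifP => _; last by rewrite mulr0 mul0r.
by split; [apply: delta_labl; apply: (aMb i j).1 | apply: delta_vertexr].
Qed.

Lemma column_expansionE : (forall i j v, val (M i j) (ptriv v) = 0) ->
  emb_mat M = emb_mat column_expansion ** up b.
Proof.
move=> M0; apply: matP => i j; rewrite mmul_up big_sumType /=.
rewrite [X in _ + X]big1 ?addr0 => [|u _]; last first.
  by rewrite /emb_mat /column_expansion /= rmorph0 mul0r.
rewrite /emb_mat -(aMb i j).2 (arrow_expansion RPE Rltrans (M0 i j)).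
rewrite mulr_suml rmorph_sum; apply: eq_bigr => e _.
rewrite /column_expansion /=.
case: eqP => [->|/eqP be].
  by rewrite -mulrA arrow_vertexR rmorphM.
by rewrite -mulrA arrow_lab // mulr0 mulr0 rmorph0.
Qed.

Lemma expansion_regular : (forall i j v, val (M i j) (ptriv v) = 0) ->
  regular (emb_mat column_expansion) -> regular (emb_mat M).
Proof.
move=> /column_expansionE ->; set N := emb_mat _.
have Nb : N ** D (expand b) = N.
  by have [] := homogeneous_emb column_expansion_homogeneous.
move=> [H [c [P [Q [PNQ NQPN]]]]]; exists H, c, P, (down b ** Q).
have ud : N ** up b ** (down b ** Q) = N ** Q.
  by rewrite mmulA -(mmulA N) up_down Nb.
by split; [rewrite -(mmulA P) ud mmulA | rewrite ud mmulA NQPN].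
Qed.

Lemma expansion_cong : (forall i j v, val (M i j) (ptriv v) = 0) ->
  cong_of_invertible a (expand b) (emb_mat column_expansion) ->
  cong_of_invertible a b (emb_mat M).
Proof.
move=> /column_expansionE ->; set N := emb_mat _.
have Nb : N ** D (expand b) = N.
  by have [] := homogeneous_emb column_expansion_homogeneous.
move=> NP Y NY YN.
apply: gc_trans (gc_sym (expand_cong b)); apply: (NP (up b ** Y)).
  by rewrite mmulA.
rewrite -mmulA -Nb -up_down (mmulA N) (mmulA Y) YN -down_up !mmulA up_down.
by rewrite -mmulA up_down (diag_idem elab_idem).
Qed.
End ColumnExpansion.

(** The Schur complement of the pivot m = M i0 j0 is M - MGM, where G = QP has a
    single nonzero entry, which inverts m up to the idempotent at u. Row i0 and
    column j0 of this complement vanish. *)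
Section Pivot.
Variables (I J : finType) (a : I -> label) (b : J -> label) (M : mat RT I J).
Hypothesis aMb : homogeneous a b M.
Variables (i0 : I) (j0 : J) (u : vert E).
Hypothesis M0 : val (M i0 j0) (ptriv u) != 0.

Definition remove (H : finType) (h0 : H) (c : H -> label) : H -> label :=
  fun h => if h == h0 then None else c h.

Let ai0 : a i0 = Some u := lab_coef (aMb i0 j0).1 M0.
Let bj0 : b j0 = Some u := coef_lab (aMb i0 j0).2 M0.

Let pivot_inverse : exists n : RT,
  M i0 j0 * n = vertex u /\ n * M i0 j0 = vertex u.
Proof.
apply: corner_inverse => //.
  by have := (aMb i0 j0).1; rewrite ai0.
by have := (aMb i0 j0).2; rewrite bj0.
Qed.

Lemma pivot_weight (H : finType) (h0 : H) (c : H -> label) : c h0 = Some u ->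
  weight c = fvertex u + weight (remove h0 c).
Proof.
move=> ch0; rewrite /weight (bigD1 h0) //= ch0; congr (_ + _).
rewrite [RHS](bigD1 h0) //= /remove eqxx add0r.
by apply: eq_bigr => h /negPf ->.
Qed.

Lemma pivot_card :
  (#|[pred i | remove i0 a i != None]| < #|[pred i | a i != None]|)%N.
Proof.
apply: proper_card; apply/properP; split.
  by apply/fintype.subsetP => i; rewrite !inE /remove; case: ifP.
by exists i0; rewrite !inE ?ai0 // /remove eqxx.
Qed.

Lemma diag_remove (H : finType) (h0 : H) (c : H -> label) :
  D c ** D (remove h0 c) = D (remove h0 c) /\
  D (remove h0 c) ** D c = D (remove h0 c).
Proof.
by split; apply: matP => h h'; rewrite diag_mmul /diag; case: (h == h');
  rewrite ?mulr0 // /remove; case: ifP => _;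
  rewrite ?elab_None ?mul0r ?mulr0 ?elab_idem.
Qed.

(* P and Q pick the pivot out of a product, P on the left and Q on the right;
   Q carries the inverse of the pivot. *)
Let P : mat T unit I := fun _ i => if i == i0 then emb (vertex u) else 0.
Let Q (n : RT) : mat T J unit := fun j _ => if j == j0 then emb n else 0.

Let PM (H : finType) (X : mat T I H) t h :
  (P ** X) t h = emb (vertex u) * X i0 h.
Proof.
rewrite /mmul (bigD1 i0) //= /P eqxx big1 ?addr0 // => i /negPf ->.
by rewrite mul0r.
Qed.

Let MQ n (H : finType) (X : mat T H J) t h : (X ** Q n) h t = X h j0 * emb n.
Proof.
rewrite /mmul (bigD1 j0) //= /Q eqxx big1 ?addr0 // => j /negPf ->.
by rewrite mulr0.
Qed.

Lemma pivot_elimination :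
  exists (P : mat T unit I) (Q : mat T J unit) (M' : mat RT I J),
  [/\ P ** emb_mat M ** Q = D (fun _ : unit => Some u),
      P ** D (remove i0 a) = 0, D (remove j0 b) ** Q = 0,
      emb_mat M' = emb_mat M - emb_mat M ** Q ** P ** emb_mat M &
      homogeneous (remove i0 a) (remove j0 b) M'].
Proof.
have [n [mn nm]] := pivot_inverse.
pose M' : mat RT I J := fun i j => M i j - M i j0 * n * M i0 j.
have vM j : vertex u * M i0 j = M i0 j by have := (aMb i0 j).1; rewrite ai0.
have Mv i : M i j0 * vertex u = M i j0 by have := (aMb i j0).2; rewrite bj0.
exists P, (Q n), M'; split.
- apply: matP => -[] []; rewrite MQ PM /diag eqxx /= /emb_mat -!rmorphM.
  by rewrite vM mn.
- apply: matP => t i; rewrite mmul_diag /P; case: eqP => [->|_].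
    by rewrite /remove eqxx elab_None mulr0.
  by rewrite mul0r.
- apply: matP => j t; rewrite diag_mmul /Q; case: eqP => [->|_].
    by rewrite /remove eqxx elab_None mul0r.
  by rewrite mulr0.
- apply: matP => i j; rewrite -(mmulA (_ ** Q n)).
  change (emb (M' i j) =
    emb (M i j) - (emb_mat M ** Q n ** (P ** emb_mat M)) i j).
  rewrite rmorphB [X in _ = _ - X](big_pred1 tt); last by case.
  by rewrite MQ PM /emb_mat -!rmorphM vM.
- move=> i j; rewrite /remove /M'; split.
    case: eqP => [->|_] /=; first by rewrite mul0r mn vM subrr.
    by rewrite mulrBr !mulrA !(aMb _ _).1.
  case: eqP => [->|_] /=; first by rewrite mulr0 -mulrA nm Mv subrr.
  by rewrite mulrBl -!mulrA !(aMb _ _).2.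
Qed.

(** From quasi-inverse data P2, Q2 of the complement N' = N - N Q1 P1 N one gets
    that of N by adding the row P1 and the column Q1. Correcting P2 and Q2 to P3
    = P2 (1 - N Q1 P1) and Q3 = (1 - Q1 P1 N) Q2 makes the off-diagonal blocks
    of the rank idempotent vanish. An inverse of N compresses to one of N'. *)
Lemma pivot_regular_cong :
  (forall M' : mat RT I J, homogeneous (remove i0 a) (remove j0 b) M' ->
     regular (emb_mat M') /\
     cong_of_invertible (remove i0 a) (remove j0 b) (emb_mat M')) ->
  regular (emb_mat M) /\ cong_of_invertible a b (emb_mat M).
Proof.
have [P1 [Q1 [M' [PMQ Pa Qb M'E M'h]]]] := pivot_elimination.
move=> /(_ _ M'h); have [aM Mb] := homogeneous_emb aMb.
have [aM' M'b] := homogeneous_emb M'h.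
move: (emb_mat M) (emb_mat M') => N N' in PMQ M'E aM Mb aM' M'b *.
have PM' : P1 ** N' = 0 by rewrite -aM' mmulA Pa; apply: matP => t i;
  apply: big1 => k _; apply: mul0r.
have M'Q : N' ** Q1 = 0.
  rewrite -M'b -mmulA Qb; apply: matP => t i.
  by apply: big1 => k _; apply: mulr0.
have mmul0m (H H' H'' : finType) (X : mat T H' H'') : (0 : mat T H H') ** X = 0.
  by apply: matP => h h'; apply: big1 => k _; apply: mul0r.
have mmulm0 (H H' H'' : finType) (X : mat T H H') : X ** (0 : mat T H' H'') = 0.
  by apply: matP => h h'; apply: big1 => k _; apply: mulr0.
move=> [[H [c [P2 [Q2 [PNQ NQPN]]]]] inv]; split.
  pose P3 := P2 - P2 ** N ** Q1 ** P1; pose Q3 := Q2 - Q1 ** P1 ** N ** Q2.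
  have P3N : P3 ** N = P2 ** N'.
    by rewrite mmulBl M'E mmulBr !mmulA.
  have NQ3 : N ** Q3 = N' ** Q2.
    by rewrite mmulBr M'E mmulBl !mmulA.
  exists (unit + H)%type, (sum_label (fun=> Some u) c).
  exists (fun h => match h with inl t => P1 t | inr h => P3 h end).
  exists (fun j h => match h with inl t => Q1 j t | inr h => Q3 j h end).
  split.
    apply: matP => h h'.
    transitivity (match h, h' with
      | inl t, inl t' => (P1 ** N ** Q1) t t'
      | inl t, inr k' => (P1 ** N ** Q3) t k'
      | inr k, inl t' => (P3 ** N ** Q1) k t'
      | inr k, inr k' => (P3 ** N ** Q3) k k'
      end); first by case: h h' => ? [].
    have -> : P1 ** N ** Q3 = 0 by rewrite -mmulA NQ3 mmulA PM' mmul0m.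
    have -> : P3 ** N ** Q1 = 0 by rewrite P3N -mmulA M'Q mmulm0.
    have -> : P3 ** N ** Q3 = D c.
      rewrite P3N mmulBr PNQ !mmulA -(mmulA P2) M'Q mmulm0 !mmul0m.
      by rewrite subr0.
    by rewrite PMQ; case: h h' => [t|k] [t'|k'].
  transitivity ((N - N') + N' ** Q2 ** P2 ** N'); last by rewrite NQPN subrK.
  have -> : N - N' = N ** Q1 ** P1 ** N by rewrite M'E subKr.
  have -> : N' ** Q2 ** P2 ** N' = N ** Q3 ** P3 ** N.
    by rewrite NQ3 -!mmulA P3N.
  rewrite -(mmulA (N ** Q1)) -(mmulA (N ** Q3)) -(mmulA (N ** _)).
  by apply: matP => i j; rewrite [LHS]big_sumType.
move=> Y NY YN; rewrite (pivot_weight ai0) (pivot_weight bj0).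
apply: gc_add; first exact: gc_refl.
have [aa _] := diag_remove i0 a; have [_ bb] := diag_remove j0 b.
apply: (inv (D (remove j0 b) ** Y ** D (remove i0 a))).
  rewrite !mmulA M'b M'E !mmulBl -(mmulA N) -!(mmulA (N ** Q1 ** P1)) NY aa.
  by rewrite -(mmulA (N ** Q1)) Pa mmulm0 subr0 mmulA NY aa.
rewrite -!mmulA aM' M'E !mmulBr !mmulA -!(mmulA _ Y N) YN bb.
by rewrite Qb !mmul0m subr0.
Qed.
End Pivot.

(** Induction on the number of labelled rows and, for a fixed number, on the
    length of a path occurring in some entry: column expansions shorten this
    path until it becomes trivial, and then it yields a pivot. *)
Lemma homogeneous_regular_cong (I J : finType) (a : I -> label)
    (b : J -> label) (M : mat RT I J) : homogeneous a b M ->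
  regular (emb_mat M) /\ cong_of_invertible a b (emb_mat M).
Proof.
have [n] := ubnP #|[pred i | a i != None]|.
elim: n => // n IHn in I J a b M *; rewrite ltnS => an aMb.
have [M0|] := pselect (forall i j p, val (M i j) p = 0).
  have -> : emb_mat M = 0.
    apply: matP => i j; rewrite /emb_mat (_ : M i j = 0) ?rmorph0 //.
    by apply: val_inj; apply/funext => p; apply: M0.
  by split; [apply: regular0 | apply: cong_of_invertible0].
move=> /existsNP[i /existsNP[j /existsNP[p /eqP Mp]]].
have [k pk] : exists k, plen p = k by exists (plen p).
elim: k => [|k IHk] in J b M aMb i j p Mp pk *.
  rewrite (plen0 pk) in Mp; apply: (pivot_regular_cong aMb Mp) => M' M'h.
  by apply: IHn M'h; apply: leq_trans an; apply: (pivot_card aMb Mp).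
have [const0|] := pselect (forall i j v, val (M i j) (ptriv v) = 0); last first.
  move=> /existsNP[i' /existsNP[j' /existsNP[v /eqP Mv]]].
  apply: (pivot_regular_cong aMb Mv) => M' M'h.
  by apply: IHn M'h; apply: leq_trans an; apply: (pivot_card aMb Mv).
have [e [q [qk Mq er]]] := ltrans_coef pk Mp.
have bj : b j = Some (rng e) by rewrite er; apply: coef_lab (aMb i j).2 Mp.
have [||reg con] := IHk _ _ _ (column_expansion_homogeneous aMb) i (j, inl e) q.
- by rewrite /column_expansion /= bj eqxx /= Mq.
- exact: qk.
by split; [apply: expansion_regular reg | apply: expansion_cong con].
Qed.

Lemma expand_homogeneous (I J : finType) (a : I -> label) (b : J -> label)
    (X : mat T I J) :
  D a ** X = X -> X ** D b = X ->
  exists (H : finType) (c : H -> label) (U : mat T H I) (U' : mat T I H)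
    (M : mat RT H J),
    [/\ U ** U' = D c, U' ** U = D a, U ** X = emb_mat M,
        homogeneous c b M & graph_cong (weight a) (weight c)].
Proof.
move=> aX Xb.
have [H [c [U [U' [M [UU' U'U UX ac]]]]]] := expand_to_subalgebra aX.
exists H, c, U, U', (diag lab c ** M ** diag lab b); split=> //.
  rewrite !emb_matM !diag_emb -UX -UU' !mmulA -(mmulA U) U'U.
  by rewrite -!mmulA Xb aX.
move=> h j; rewrite mmul_diag diag_mmul; split.
  by rewrite !mulrA lab_idem.
by rewrite -!mulrA lab_idem.
Qed.

(** An equivalence is an isomorphism X1; an expansion of its target turns it
    into a matrix over the subalgebra that is invertible over T. *)
Lemma equivalent_diag_cong (I J : finType) (a : I -> label) (b : J -> label) :
  equivalent (D a) (D b) -> graph_cong (weight a) (weight b).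
Proof.
move=> [X [Y [XY YX]]].
have DD := diag_idem elab_idem.
pose X1 := D a ** X.
have aX : D a ** X1 = X1 by rewrite mmulA DD.
have X1b : X1 ** D b = X1 by rewrite -YX mmulA -(mmulA (D a)) XY DD.
have X1Y : X1 ** Y = D a by rewrite -mmulA XY DD.
have YX1 : Y ** X1 = D b by rewrite /X1 -XY !mmulA YX -mmulA YX DD.
have [H [c [U [U' [M [UU' U'U UX Mh ac]]]]]] := expand_homogeneous aX X1b.
apply: (gc_trans ac); apply: ((homogeneous_regular_cong Mh).2 (Y ** U')).
  by rewrite -UX mmulA -(mmulA U) X1Y -U'U mmulA UU' -mmulA UU' DD.
by rewrite -UX mmulA -(mmulA Y) U'U -mmulA aX YX1.
Qed.

(** As the vertices sum to 1, the free module is standard and e is equivalent to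
    an idempotent endomorphism f of a standard module. Then f = U'M with M over
    the subalgebra and U' an isomorphism, and the factors of the quasi-inverse
    of M give the equivalence of f with D d. *)
Lemma equivalent_to_diag (I : finType) (e : mat T I I) : e ** e = e ->
  exists (H : finType) (c : H -> label), equivalent e (D c).
Proof.
move=> ee; have DD := diag_idem elab_idem.
pose a (k : I * vert E) : label := Some k.2.
pose F : mat T I (I * vert E)%type :=
  fun i k => if k.1 == i then emb (vertex k.2) else 0.
pose F' : mat T (I * vert E)%type I :=
  fun k i => if k.1 == i then emb (vertex k.2) else 0.
have FF' : e ** F ** F' = e.
  apply: matP => i i'; rewrite {1}/mmul.
  transitivity (\sum_k \sum_v (e ** F) i (k, v) * F' (k, v) i').
    by rewrite pair_bigA; apply: eq_bigr => -[].
  rewrite (bigD1 i') //= [X in _ + X]big1 ?addr0 => [|k nk]; last first.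
    by apply: big1 => v _; rewrite /F' /= (negPf nk) mulr0.
  transitivity (\sum_v e i i' * emb (vertex v)).
    apply: eq_bigr => v _; rewrite /F' /= eqxx.
    have -> : (e ** F) i (i', v) = e i i' * emb (vertex v).
      rewrite /mmul (bigD1 i') //= /F eqxx big1 ?addr0 // => k.
      by rewrite eq_sym => /negPf /= ->; rewrite mulr0.
    by rewrite -mulrA -rmorphM vertex_mul eqxx.
  by rewrite -mulr_sumr -rmorph_sum sum_vertex rmorph1 mulr1.
have F'a : D a ** F' = F'.
  apply: matP => k i; rewrite diag_mmul /F' /a /=; case: eqP => _.
    by rewrite -rmorphM vertex_mul eqxx.
  by rewrite mulr0.
have Fa : F ** D a = F.
  apply: matP => i k; rewrite mmul_diag /F /a /=; case: eqP => _.
    by rewrite -rmorphM vertex_mul eqxx.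
  by rewrite mul0r.
pose f := F' ** e ** F.
have ff : f ** f = f.
  rewrite /f !mmulA -(mmulA F' e F) -(mmulA F' _ F') FF' -(mmulA F' e e) ee.
  by rewrite mmulA.
have ef : equivalent e f.
  exists (e ** F), (F' ** e); split; first by rewrite mmulA FF' ee.
  by rewrite mmulA -(mmulA F') ee.
have [||H [c [U [U' [M [UU' U'U UX Mh ac]]]]]] := @expand_homogeneous _ _ a a f.
- by rewrite /f !mmulA F'a.
- by rewrite /f -(mmulA (F' ** e)) Fa.
have [[L [d [P [Q [PMQ MQPM]]]]] _] := homogeneous_regular_cong Mh.
exists L, d; apply: (equivalent_trans ee (DD _ _) ef).
have U'M : U' ** emb_mat M = f by rewrite -UX mmulA U'U /f !mmulA F'a.
exists (U' ** emb_mat M ** Q), (P ** emb_mat M); split.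
  by rewrite mmulA -!(mmulA U') MQPM.
rewrite U'M mmulA -UX -(mmulA P) -(mmulA U) ff UX.
by rewrite PMQ.
Qed.

(** * The graph monoid of standard modules *)

Local Notation std := (standard elab_idem).

Definition standard_class (x : free_monoid E) : Vmon T :=
  Vcls (std (@canonical_label E x)).

Lemma standard_classE (I : finType) (a : I -> label) :
  Vcls (std a) = standard_class (weight a).
Proof.
apply/VclsP/image_iso/(relabel elab_idem elab_None).
by rewrite weight_canonical.
Qed.

Lemma standard_classD x y :
  standard_class (x + y) = Vadd (standard_class x) (standard_class y).
Proof.
rewrite Vadd_cls -(weight_canonical x) -(weight_canonical y) -weight_sum.
rewrite -!standard_classE !weight_canonical.
by apply/VclsP/standard_sum.
Qed.

Lemma standard_class0 : standard_class 0 = Vzero T.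
Proof.
have w0 : weight (fun v : void => of_void label v) = 0.
  by apply: big1; case.
by rewrite -w0 -standard_classE; apply/VclsP/standard_void.
Qed.

Lemma standard_class_vertex v
    (v_idem : emb (vertex v) * emb (vertex v) = emb (vertex v)) :
  standard_class (fvertex v) = Vcls (fg_right v_idem).
Proof.
have wv : weight (fun _ : unit => Some v) = fvertex v.
  by rewrite /weight (big_pred1 tt) //; case.
rewrite -wv -standard_classE; apply/VclsP.
exact: (@standard_unit _ _ _ elab_idem (Some v) v_idem).
Qed.

Lemma standard_class_cong x y :
  graph_cong x y -> standard_class x = standard_class y.
Proof.
elim=> {x y} [v vX|//|x y _ -> //|x y z _ -> _ -> //|x x' y y' _ xx' _ yy'];
  last by rewrite !standard_classD xx' yy'.
pose a := fun _ : unit => Some v.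
have <- : weight a = fvertex v by rewrite /weight (big_pred1 tt) //; case.
have <- : weight (expand a) = \sum_(e : arr E | rng e == v) fvertex (src e).
  rewrite -step_label_weight ?enteredP //.
  transitivity (\sum_(t : unit) \sum_o label_weight (step_label (a t) o)).
    by rewrite pair_bigA.
  by rewrite (big_pred1 tt) //; case.
rewrite -!standard_classE; apply/VclsP/image_iso.
by exists (down a), (up a); split; [apply: down_up | apply: up_down].
Qed.

Lemma standard_class_inj x y :
  standard_class x = standard_class y -> graph_cong x y.
Proof.
move=> /VclsP/image_iso/equivalent_diag_cong.
by rewrite !weight_canonical.
Qed.

Lemma standard_class_surj (C : Vmon T) : exists x, standard_class x = C.
Proof.
have [N ->] := Vcls_surj C; have [n [e [ee Ne]]] := fgproj_image N.
have [H [c ec]] := equivalent_to_diag ee.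
exists (weight c); rewrite -standard_classE; apply/VclsP/mod_iso_sym.
by apply: mod_iso_trans Ne _; apply/image_iso.
Qed.

Lemma graph_monoid_iso : exists phi : graph_monoid E -> Vmon T,
  [/\ bijective phi, phi 0 = Vzero T,
      forall x y, phi (x + y) = Vadd (phi x) (phi y) &
      forall v (v_idem : emb (vertex v) * emb (vertex v) = emb (vertex v)),
        phi (gvertex v) = Vcls (fg_right v_idem)].
Proof.
pose phi (x : graph_monoid E) := standard_class (repr x).
have phiE x : phi (gpi x) = standard_class x.
  by apply/standard_class_cong/gpiP/gpi_repr.
exists phi; split.
- have /choice[g gK] : forall C, exists x, phi x = C.
    by move=> C; have [x <-] := standard_class_surj C; exists (gpi x).
  exists g => // x; rewrite -(gpi_repr x) -(gpi_repr (g _)).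
  by apply/gpiP/standard_class_inj; rewrite -/(phi _) gK gpi_repr.
- by rewrite -standard_class0 -phiE.
- move=> x y; rewrite -(gpi_repr x) -(gpi_repr y) [_ + _]gm_addE !phiE.
  exact: standard_classD.
- by move=> v v_idem; rewrite phiE standard_class_vertex.
Qed.
End CuntzKriegerExtension.

(** * The quiver ring *)

Lemma subring_gen_ind (A : pzRingType) (G : set A) (P : subring_gen G -> Prop) :
  P 1 -> (forall x y, P x -> P y -> P (x - y)) ->
  (forall x y, P x -> P y -> P (x * y)) ->
  (forall g (Gg : G g), P (sgen Gg)) -> forall x, P x.
Proof.
move=> P1 PB PM Pgen x.
pose B : {pred A} := fun y => `[< exists yG : y \in in_subring_gen G,
  P (exist _ y yG) >].
have inB (y : subring_gen G) : P y -> val y \in B.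
  move=> Py; apply/asboolP; exists (valP y).
  by rewrite (_ : exist _ _ _ = y) //; apply: val_inj.
have clB : GRing.subring_closed B.
  split=> [|y z /asboolP[yG Py] /asboolP[zG Pz]
          |y z /asboolP[yG Py] /asboolP[zG Pz]].
  - exact: (inB 1 P1).
  - exact: (inB _ (PB _ _ Py Pz)).
  - exact: (inB _ (PM _ _ Py Pz)).
have /asboolP/(_ B clB) := valP x => /(_ _)/asboolP [] => [g Gg|xG Px].
  by apply/asboolP; exists (mem_subring_gen Gg); apply: Pgen.
by rewrite (_ : x = exist _ (val x) xG) //; apply: val_inj.
Qed.

Section QuiverRing.
Variables (K : fieldType) (E : quiver) (R : {pred pseries K E}).
Hypothesis Ralg : subalgebra R.
Hypothesis RPE : forall f, finitely_supported f -> f \in R.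
Hypothesis Rltrans : forall e, {in R, forall f, ltrans e f \in R}.

Local Notation RT := (subalg_type Ralg).
Local Notation S := (skew_ring Ralg Rltrans).
Local Notation T := (quiver_ring Ralg RPE Rltrans).
Local Notation vertex := (@vertex K E R Ralg RPE).
Local Notation arrow := (@arrow K E R Ralg RPE).
Local Notation delta := (@delta_fun K E R Ralg Rltrans).
Local Notation act := (fun (x : RT) (s : S) => eapp (val s) x).

Definition skew_emb (r : RT) : S := @skew_of K E R Ralg Rltrans r.
Definition skew_delta (e : arr E) : S := @skew_bar K E R Ralg Rltrans e.

Lemma valB (x y : RT) p : val (x - y) p = val x p - val y p.
Proof. by []. Qed.
Lemma valM (x y : RT) : val (x * y) = val x * val y. Proof. by []. Qed.

Lemma skew_ext (s t : S) : (forall x, act x s = act x t) -> s = t.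
Proof. by move=> st; apply/val_inj/endoP. Qed.

Lemma act_emb x r : act x (skew_emb r) = x * r. Proof. by []. Qed.
Lemma act_delta x e : act x (skew_delta e) = delta e x. Proof. by []. Qed.
Lemma actM x s t : act x (s * t) = act (act x s) t. Proof. by []. Qed.
Lemma actB x s t : act x (s - t) = act x s - act x t. Proof. by []. Qed.
Lemma act_sum x (I : finType) (P : pred I) (F : I -> S) :
  act x (\sum_(i | P i) F i) = \sum_(i | P i) act x (F i).
Proof. exact: (big_morph (act x)). Qed.

Lemma act0 s : act 0 s = 0. Proof. exact: (linear0 (val s)). Qed.

Lemma skew_emb_zmod : zmod_morphism skew_emb.
Proof. by move=> r s; apply: skew_ext => x; rewrite actB !act_emb mulrBr. Qed.

Lemma skew_emb_monoid : monoid_morphism skew_emb.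
Proof.
split=> [|r s]; apply: skew_ext => x; first by rewrite act_emb mulr1.
by rewrite actM !act_emb mulrA.
Qed.

Local Notation pi := (@qpi S (skew_qtot Ralg RPE Rltrans)).

Definition quiver_emb (r : RT) : T := pi (skew_emb r).
Definition quiver_bar (e : arr E) : T := pi (skew_delta e).

Lemma quiver_emb_zmod : zmod_morphism quiver_emb.
Proof. by move=> r s; rewrite /quiver_emb skew_emb_zmod rmorphB. Qed.

Lemma quiver_emb_monoid : monoid_morphism quiver_emb.
Proof.
by split=> [|r s]; rewrite /quiver_emb ?skew_emb_monoid.1 ?skew_emb_monoid.2
  ?rmorph1 ?rmorphM.
Qed.

HB.instance Definition _ :=
  GRing.isZmodMorphism.Build RT T quiver_emb quiver_emb_zmod.
HB.instance Definition _ :=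
  GRing.isMonoidMorphism.Build RT T quiver_emb quiver_emb_monoid.

Lemma delta_mul_vertex e r v :
  delta e (r * vertex v) = if rng e == v then delta e r else 0.
Proof. by apply: val_inj; rewrite [LHS]ltrans_vertex; case: eqP. Qed.

Lemma delta_mul_arrow e f r :
  delta f (r * arrow e) = if f == e then r * vertex (src e) else 0.
Proof.
by apply: val_inj; rewrite [LHS]ltrans_mul_arrow; case: eqP => [->|].
Qed.

Lemma quiver_range_bar e :
  quiver_emb (vertex (rng e)) * quiver_bar e = quiver_bar e.
Proof.
rewrite -qpiM; congr qpi; apply: skew_ext => x.
by rewrite actM act_emb !act_delta delta_mul_vertex eqxx.
Qed.

Lemma quiver_arrow_bar e f : quiver_emb (arrow e) * quiver_bar f =
  if e == f then quiver_emb (vertex (src e)) else 0.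
Proof.
rewrite -qpiM.
transitivity (pi (if e == f then skew_emb (vertex (src e)) else 0)).
  congr qpi; apply: skew_ext => x.
  rewrite actM act_emb act_delta delta_mul_arrow eq_sym.
  by case: eqP => // _; rewrite act_emb.
by case: eqP => // _; apply: rmorph0.
Qed.

Lemma act_q x i : act x (skew_q Ralg RPE Rltrans i) =
  x * vertex i - \sum_(e : arr E | rng e == i) delta e x * arrow e.
Proof. by rewrite /skew_q actB act_sum. Qed.

Lemma quiver_bar_arrow v : [exists e : arr E, rng e == v] ->
  \sum_(e : arr E | rng e == v) quiver_bar e * quiver_emb (arrow e) =
  quiver_emb (vertex v).
Proof.
move=> vX; symmetry; apply/eqP; rewrite -subr_eq0; apply/eqP.
transitivity (pi (skew_q Ralg RPE Rltrans v)).
  by rewrite /skew_q rmorphB rmorph_sum; congr (_ - _); apply: eq_bigr => e _;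
    rewrite rmorphM.
rewrite -(rmorph0 pi); apply/qpiP; rewrite subr0; apply/asboolP.
exists 1%N, (fun=> skew_emb (vertex v)), (fun=> 1); rewrite big_ord1 mulr1.
apply: skew_ext => x; rewrite actM act_emb /skew_qtot act_sum.
rewrite (bigD1 v) // big1 => [|w /andP[_ wv]].
  rewrite [RHS]addr0 !act_q -mulrA vertex_mul eqxx; congr (_ - _).
  by apply: eq_bigr => e /eqP ev; rewrite delta_mul_vertex ev eqxx.
rewrite act_q -mulrA vertex_mul eq_sym (negPf wv) mulr0.
rewrite big1 ?subr0 // => e /eqP ew.
by rewrite delta_mul_vertex ew (negPf wv) mul0r.
Qed.

Lemma quiver_ind (P : T -> Prop) : P 1 ->
  (forall x y, P x -> P y -> P (x - y)) ->
  (forall x y, P x -> P y -> P (x * y)) ->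
  (forall r, P (quiver_emb r)) -> (forall e, P (quiver_bar e)) ->
  forall t, P t.
Proof.
move=> P1 PB PM Pemb Pbar t; rewrite -(qpi_repr t).
elim/subring_gen_ind: (repr t : S) => [|x y Px Py|x y Px Py|g Gg].
- by rewrite rmorph1.
- by rewrite rmorphB; apply: PB.
- by rewrite rmorphM; apply: PM.
have [[r gE]|[e gE]] : skew_generators Rltrans g := Gg.
  rewrite (_ : sgen Gg = skew_emb r); first exact: Pemb.
  exact: val_inj.
rewrite (_ : sgen Gg = skew_delta e); first exact: Pbar.
exact: val_inj.
Qed.

(** The paths that start at a source are exempt: no arrow can be put in front of
    them, so a vertex may fail to be the range of longer paths. *)
Definition vanishes_below (n : nat) (x : RT) : Prop := forall p : qpath E,
  (plen p < n)%N -> [exists e : arr E, rng e == psrc p] -> val x p = 0.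

Lemma vanishes_below_leq n m x : (n <= m)%N ->
  vanishes_below m x -> vanishes_below n x.
Proof. by move=> nm xm p pn; apply: xm; apply: leq_trans nm. Qed.

(** Right multiplications do not shorten paths, a transduction removes one arrow
    at the end, and neither changes sources. *)
Lemma act_vanishes (s : S) : exists m, forall n x,
  vanishes_below (n + m) x -> vanishes_below n (act x s).
Proof.
elim/subring_gen_ind: s => [|s t [k sk] [m tm]|s t [k sk] [m tm]|g Gg].
- by exists 0%N => n x; rewrite addn0.
- exists (maxn k m) => n x xn p pn pX.
  rewrite actB valB.
  rewrite (sk n) ?(tm n) ?subrr //; apply: vanishes_below_leq xn;
    by rewrite leq_add2l ?leq_maxl ?leq_maxr.
- exists (m + k)%N => n x xn; rewrite actM; apply: tm; apply: sk.
  by rewrite -addnA.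
have [[r gE]|[e gE]] : skew_generators Rltrans g := Gg.
  rewrite (_ : sgen Gg = skew_emb r); last exact: val_inj.
  exists 0%N => n x; rewrite addn0 => xn p pn pX; rewrite act_emb.
  rewrite valM psM; apply: big1 => k _; rewrite xn ?mul0r //.
  have kp : (k <= plen p)%N by rewrite -ltnS.
  by rewrite size_ptake //; apply: leq_ltn_trans pn.
rewrite (_ : sgen Gg = skew_delta e); last exact: val_inj.
exists 1%N => n x xn p pn pX; rewrite act_delta /= /ltrans.
have [pe|/pcat_arrow_None -> //] := eqVneq (prng p) (src e).
have [q [pq ql _ _ _]] := pcat_arrowP pe; rewrite pq; apply: xn.
  by rewrite ql addn1.
by rewrite (psrc_cat pq).
Qed.

(** By the expansion through the last arrow, q_i maps x to its term at the
    trivial path at i. *)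
Lemma act_qtot x : vanishes_below 1 x ->
  act x (skew_qtot Ralg RPE Rltrans) = 0.
Proof.
move=> x1; rewrite /skew_qtot act_sum big1 // => i iX; rewrite act_q.
have xi v : val (x * vertex i) (ptriv v) = 0.
  rewrite valM ps_mul_vertex; case: eqP => // vi.
  by apply: x1; rewrite // -vi in iX.
rewrite {1}(arrow_expansion RPE Rltrans xi) [X in _ - X]big_mkcond.
rewrite -sumrB big1 // => e _; rewrite delta_mul_vertex.
by case: ifP; rewrite ?mul0r subrr.
Qed.

Lemma long_path n v : exists p : qpath E, prng p = v /\
  ((n <= plen p)%N \/ ~~ [exists e : arr E, rng e == psrc p]).
Proof.
elim: n => [|n [p [pv [np|pX]]]]; first by exists (ptriv v); split=> //; left.
  have [/existsP[e /eqP ep]|] := boolP [exists e : arr E, rng e == psrc p].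
    have qP : is_path (src e) (e :: parrs p).
      by rewrite /= eqxx ep (valP p).
    exists (exist _ (src e, e :: parrs p) qP); split; last by left.
    by rewrite -pv /prng /psrc /parrs /= /pend /= ep.
  by exists p; split=> //; right.
by exists p; split=> //; right.
Qed.

(** An element of the ideal annihilates every long path, and every path that
    starts at a source, because q only sees constant terms at entered vertices.
    One of these paths ends at v, and vertex v fixes it. *)
Lemma quiver_vertex_neq0 v : quiver_emb (vertex v) <> 0.
Proof.
rewrite -(rmorph0 pi) => /qpiP; rewrite subr0 => /asboolP[n [a [b vE]]].
have /choice[m mP] k := act_vanishes (a k).
pose N := (\max_k m k).+1.
have [p [pv pN]] := long_path N v.
pose x : RT := path_in Ralg RPE p.
have xN : vanishes_below N x.
  move=> q qN qX; rewrite /= /ps_path; case: eqP => // qp.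
  by case: pN; rewrite -qp ?qX // leqNgt qN.
have : act x (skew_emb (vertex v)) = 0.
  rewrite vE act_sum big1 // => k _; rewrite !actM act_qtot ?act0 //.
  apply: (mP k); apply: vanishes_below_leq xN.
  by rewrite add1n ltnS (leq_bigmax k).
move/(congr1 (fun y : RT => val y p)).
move/eqP; rewrite (_ : val _ _ = 1) ?oner_eq0 //.
by rewrite act_emb valM ps_mul_vertex pv eqxx [val x p]/= /ps_path eqxx.
Qed.
End QuiverRing.

Theorem theorem3p1 (K : fieldType) (E : quiver) (R : {pred pseries K E})
    (Ralg : subalgebra R)
    (RPE : forall f : pseries K E, finitely_supported f -> f \in R)
    (Rinv : inversion_closed R)
    (Rltrans : forall e : arr E, {in R, forall f, ltrans e f \in R})
    (Rrtrans : forall e : arr E, {in R, forall f, rtrans e f \in R}) :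
  exists phi : graph_monoid E -> Vmon (quiver_ring Ralg RPE Rltrans),
    [/\ bijective phi,
        phi 0 = Vzero (quiver_ring Ralg RPE Rltrans),
        forall x y, phi (x + y) = Vadd (phi x) (phi y)
      & forall v, phi (gvertex v) = Vcls (vertex_module Ralg RPE Rltrans v)].
Proof.
have [phi [phi_bij phi0 phiD phiv]] := graph_monoid_iso Rinv Rltrans
  (@quiver_range_bar K E R Ralg RPE Rltrans)
  (@quiver_arrow_bar K E R Ralg RPE Rltrans)
  (@quiver_bar_arrow K E R Ralg RPE Rltrans)
  (@quiver_ind K E R Ralg RPE Rltrans)
  (@quiver_vertex_neq0 K E R Ralg RPE Rltrans).
exists phi; split=> // v.
exact: (phiv v (quiver_vertex_idem Ralg RPE Rltrans v)).
Qed.
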